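(* Let $p>3$ be a prime. Then $$\sum_{k=1}^{p-1}\frac{H_k^{(2)}}{k\,16^k}\binom{2k}{k}^2\equiv-12\,\frac{H_{p-1}}{p^2}+\frac{7}{10}\,p^2B_{p-5}\pmod{p^3}$$ and $$\sum_{k=\frac{p+1}{2}}^{p-1}\frac{H_k^{(2)}}{k\,16^k}\binom{2k}{k}^2\equiv\frac{31}{2}\,p^2B_{p-5}\pmod{p^3}.$$
   Context: For positive integers $r,n$, $H_n^{(r)}=\sum_{j=1}^n j^{-r}$, with $H_0^{(r)}=0$, and $H_n=H_n^{(1)}$. The Bernoulli numbers $B_n$ are defined by $\sum_{n\ge0}B_n t^n/n!=t/(e^t-1)$. For $p$-adic integers (rationals with denominators prime to $p$) $x,y$, $x\equiv y\pmod{p^m}$ means $x-y\in p^m\mathbb{Z}_p$. (By Wolstenholme's theorem $H_{p-1}/p^2$ is $p$-integral for $p>3$.) *)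

(* Defs.v *)
From mathcomp Require Import all_boot all_order all_algebra.
Set Implicit Arguments. Unset Strict Implicit. Unset Printing Implicit Defensive.
Import Order.TTheory GRing.Theory Num.Theory.
Local Open Scope ring_scope.

Definition harm (r n : nat) : rat :=
  \sum_(1 <= j < n.+1) 1 / (j%:R ^+ r).

(* Bernoulli numbers (convention t/(e^t-1), so B_1 = -1/2), via the
   equivalent standard recurrence sum_{k=0}^{n} C(n+1,k) B_k = 0 (n >= 1),
   B_0 = 1.  bern_seq n = [:: B_0; ...; B_n]. *)
Fixpoint bern_seq (n : nat) : seq rat :=
  match n with
  | 0 => [:: 1]
  | m.+1 => let s := bern_seq m in
      rcons s (- (1 / (m.+2)%:R) * \sum_(k < m.+1) ('C(m.+2, k))%:R * s`_k)
  end.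

Definition bernoulli (n : nat) : rat := (bern_seq n)`_n.

Definition p_integral (p : nat) (x : rat) : bool := ~~ (p %| `|denq x|)%N.

Definition congr_pm (p m : nat) (x y : rat) : Prop :=
  p_integral p ((x - y) / (p ^ m)%:R).

Example bern_check : [:: bernoulli 0; bernoulli 1; bernoulli 2; bernoulli 4]
   = [:: 1; -(1/2); 1/6; -(1/30)].
Proof. by rewrite /bernoulli /= !big_ord_recr !big_ord0 /=; apply/eqP. Qed.

(* Main.v *)
(** The terms are values at [z = -1/2] of the polynomials
      [P_k(z) = (-z)_k (z+1)_k / k!^2],
    for which [F_N(z) = sum_(k <= N) H_k^(2)/k P_k(z)] satisfies the telescoping identity
      [z^3 (F_N(z) - F_N(z-1)) = 2 (R_N(z) (z^2 H_N^(2) + 1) - 1)],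
    where [R_N(z) = prod_(j <= N) (1 - z^2/j^2)].  Put [n = (p-1)/2] and [b = B_(p-5)].

    Exactly, [F_n(n) = -2 H_n^(3)].  As [z(z+1)] differs by [p^2/4] between [z = n] and
    [z = -1/2], modulo [p^3] the head [F_n(-1/2)] and the tail [F_(p-1)(-1/2) - F_n(-1/2)]
    only require [F_n''(-1/2)] and [(F_(p-1) - F_n)''(-1/2)] modulo [p].  Over the field with
    [p] elements [H_n^(2)] vanishes and [R_n(z) = 1 - z^(p-1)], [R_(p-1) = R_n^2], so that
    [F_n(z) - F_n(z-1) = -2 z^(p-4)], while [F_(p-1) - F_n = (z^p - z) V(z)] with
    [V(z) - V(z-1) = 2 z^(p-5)].  Polynomials of degree less than [p] being determined up to
    a constant by their differences, [F_n] and [V] are Bernoulli polynomials, and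
    [B_(p-5)(1/2) = 31 b] gives both second derivatives.

    Finally, pairing [d] with [p - d] over all [d <= n], or over the even [d < p], yields two
    expansions of [H_(p-1)] and of [H_(p-1)^(3)] in the [H_n^(r)], whence
    [-2 H_n^(3) = -12 H_(p-1)/p^2 - 27/10 p^2 H_n^(5)] modulo [p^3], and [H_n^(5) = -6 b]
    modulo [p].  The divisions exclude [p = 5], which is a computation. *)
Require Import Defs.
From mathcomp Require Import all_boot all_order all_algebra all_field.
From mathcomp Require Import ring lra zify.
Import Order.TTheory GRing.Theory Num.Theory.
Local Open Scope ring_scope.
Set Implicit Arguments. Unset Strict Implicit.

(** * The telescoping identity *)

(* [c i] plays the role of [1/i], so that the same identities serve over [rat], ['F_p] and
   [{poly 'F_p}]; [legP c (z * (z + 1)) k] is [P_k(z)]. *)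
Definition legP (A : comNzRingType) (c : nat -> A) (v : A) (k : nat) : A :=
  \prod_(i < k) ((i%:R * i.+1%:R - v) * c i.+1 ^+ 2).
Definition legR (A : comNzRingType) (c : nat -> A) (z : A) (k : nat) : A :=
  \prod_(i < k) (1 - z ^+ 2 * c i.+1 ^+ 2).
Definition hsum (A : comNzRingType) (c : nat -> A) (r k : nat) : A :=
  \sum_(i < k) c i.+1 ^+ r.
Definition legF (A : comNzRingType) (c : nat -> A) (v : A) (N : nat) : A :=
  \sum_(k < N) hsum c 2 k.+1 * c k.+1 * legP c v k.+1.

(** As i(i+1) - z(z+1) = (i - z)(i + 1 + z), the factor i - z of each index pairs with the factor i
    + z of the preceding one into i^2 - z^2. Only -z from the first index and k + 1 + z from the
    last stay unpaired. *)
Lemma legP_legR (A : comNzRingType) (c : nat -> A) (z : A) (k : nat)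
    (hc : forall i, (i < k)%N -> i.+1%:R * c i.+1 = 1) :
  legP c (z * (z + 1)) k.+1 = - z * (k.+1%:R + z) * c k.+1 ^+ 2 * legR c z k.
Proof.
elim: k hc => [|k IH] hc.
  by rewrite /legP /legR big_ord_recr /= !big_ord0; ring.
rewrite /legP big_ord_recr /= -/(legP c _ k.+1) IH; last first.
  by move=> i /ltnW; apply: hc.
rewrite /legR big_ord_recr /= -/(legR c z k).
have h := hc k (ltnSn k).
set C := c k.+1 in h *; set D := c k.+2; set R := legR c z k.
have -> : 1 - z ^+ 2 * C ^+ 2 = (k.+1%:R * C) ^+ 2 - z ^+ 2 * C ^+ 2 by rewrite h; ring.
have -> : k.+2%:R = k.+1%:R + 1 :> A by rewrite -natr1.
ring.
Qed.

(** The substitution z -> -z exchanges z(z+1) with (z-1)z and fixes [legR]. *)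
Lemma legP_sym (A : comNzRingType) (c : nat -> A) (z : A) (k : nat)
    (hc : forall i, (i < k)%N -> i.+1%:R * c i.+1 = 1) :
  legP c ((z - 1) * z) k.+1 = z * (k.+1%:R - z) * c k.+1 ^+ 2 * legR c z k.
Proof.
have -> : (z - 1) * z = - z * (- z + 1) by ring.
rewrite legP_legR //; have -> : legR c (- z) k = legR c z k.
  by rewrite /legR; apply: eq_bigr => i _; rewrite sqrrN.
ring.
Qed.

(** By the two factorizations, P_k(z) - P_k(z-1) = -2 z R_(k-1)(z) / k, since -z(k+z) - z(k-z) =
    -2zk. Hence passing from k - 1 to k changes both sides by -2 z^4 H_k^(2) R_(k-1)(z) / k^2. *)
Lemma legF_diff (A : comNzRingType) (c : nat -> A) (z : A) (N : nat)
    (hc : forall i, (i < N)%N -> i.+1%:R * c i.+1 = 1) :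
  z ^+ 3 * (legF c (z * (z + 1)) N - legF c ((z - 1) * z) N) =
  (legR c z N * (z ^+ 2 * hsum c 2 N + 1) - 1) *+ 2.
Proof.
elim: N hc => [|N IH] hc.
  by rewrite /legF /legR /hsum !big_ord0; ring.
have hN : forall i, (i < N)%N -> i.+1%:R * c i.+1 = 1.
  by move=> i /ltnW; apply: hc.
have hs r : hsum c r N.+1 = hsum c r N + c N.+1 ^+ r.
  by rewrite /hsum big_ord_recr.
have hF v : legF c v N.+1 = legF c v N + hsum c 2 N.+1 * c N.+1 * legP c v N.+1.
  by rewrite /legF big_ord_recr.
have hR : legR c z N.+1 = legR c z N * (1 - z ^+ 2 * c N.+1 ^+ 2).
  by rewrite /legR big_ord_recr.
rewrite !hF hR legP_legR // legP_sym // hs.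
have h := hc N (ltnSn N); have {IH hN} := IH hN.
move: (legF c (z * (z + 1)) N) (legF c ((z - 1) * z) N) => F1 F2.
move: h; move: (c N.+1) (legR c z N) (hsum c 2 N) => C R H h E.
(* The product [N.+1%:R * C] is kept as a separate factor so that [h] can replace it by 1. *)
transitivity (z ^+ 3 * (F1 - F2)
    - 2%:R * z ^+ 4 * (H + C ^+ 2) * C ^+ 2 * R * (N.+1%:R * C)); first by ring.
by rewrite E h; ring.
Qed.

(** * Residues of p-integral rationals *)

(* The rational [x] is [p]-integral with residue [a]. *)
Definition Rd (p : nat) (x : rat) (a : 'F_p) : Prop :=
  exists m d : int,
    [/\ d%:~R != 0 :> 'F_p, x = m%:~R / d%:~R & a = m%:~R / d%:~R].

Lemma intr_neq0_Fp (p : nat) (d : int) :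
  d%:~R != 0 :> 'F_p -> d%:~R != 0 :> rat.
Proof. by apply: contra_neq => /eqP; rewrite intr_eq0 => /eqP ->. Qed.

Lemma intr_Fp_eq0 (p : nat) (hp : prime p) (d : int) :
  (d%:~R == 0 :> 'F_p) = (p %| `|d|)%N.
Proof.
rewrite (dvdn_pcharf (pchar_Fp hp)).
case: d => n; first by rewrite -pmulrn absz_nat.
by rewrite NegzE mulrNz oppr_eq0 abszN absz_nat.
Qed.

Lemma Rd_int (p : nat) (m : int) : @Rd p m%:~R m%:~R.
Proof. by exists m, 1; split; rewrite ?divr1 // oner_neq0. Qed.

Lemma Rd_nat (p : nat) (m : nat) : @Rd p m%:R m%:R.
Proof. exact: (Rd_int p m). Qed.

Lemma Rd_add (p : nat) (x y : rat) (a b : 'F_p) :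
  Rd x a -> Rd y b -> Rd (x + y) (a + b).
Proof.
move=> [m [d [hd -> ->]]] [m' [d' [hd' -> ->]]].
have Hd := intr_neq0_Fp hd; have Hd' := intr_neq0_Fp hd'.
exists (m * d' + m' * d), (d * d'); rewrite !(intrD, intrM).
split; [by rewrite mulf_neq0| |]; field.
  exact/andP.
exact/andP.
Qed.

Lemma Rd_mul (p : nat) (x y : rat) (a b : 'F_p) :
  Rd x a -> Rd y b -> Rd (x * y) (a * b).
Proof.
move=> [m [d [hd -> ->]]] [m' [d' [hd' -> ->]]].
exists (m * m'), (d * d'); rewrite !intrM.
by split; rewrite ?mulf_neq0 // invfM mulrACA.
Qed.

Lemma Rd_muln (p : nat) (x : rat) (a : 'F_p) (n : nat) :
  Rd x a -> Rd (x *+ n) (a *+ n).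
Proof.
by move=> h; rewrite -[x *+ n]mulr_natr -[a *+ n]mulr_natr; apply/Rd_mul/Rd_nat.
Qed.

Lemma Rd_opp (p : nat) (x : rat) (a : 'F_p) : Rd x a -> Rd (- x) (- a).
Proof.
by move=> [m [d [hd -> ->]]]; exists (- m), d; rewrite !intrN !mulNr.
Qed.

Lemma Rd_sub (p : nat) (x y : rat) (a b : 'F_p) :
  Rd x a -> Rd y b -> Rd (x - y) (a - b).
Proof. by move=> hx hy; apply/Rd_add/Rd_opp. Qed.

Lemma Rd_inv (p : nat) (x : rat) (a : 'F_p) :
  a != 0 -> Rd x a -> Rd x^-1 a^-1.
Proof.
move=> ha [m [d [hd -> ha']]]; exists d, m; rewrite ha' !invfM !invrK.
split; [|by rewrite mulrC..].
by apply: contra_neq ha => h; rewrite ha' h mul0r.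
Qed.

Lemma Rd_exp (p : nat) (x : rat) (a : 'F_p) (r : nat) :
  Rd x a -> Rd (x ^+ r) (a ^+ r).
Proof.
move=> h; elim: r => [|r IH]; first exact: (Rd_nat p 1).
by rewrite !exprS; apply: Rd_mul.
Qed.

Lemma Rd_sum (p : nat) (I : eqType) (s : seq I) (F : I -> rat) (G : I -> 'F_p) :
  (forall i, i \in s -> Rd (F i) (G i)) ->
  Rd (\sum_(i <- s) F i) (\sum_(i <- s) G i).
Proof.
elim: s => [|i s IH] h; first by rewrite !big_nil; apply: (Rd_nat p 0).
rewrite !big_cons; apply: Rd_add; first by apply: h; rewrite mem_head.
by apply: IH => j hj; apply: h; rewrite inE hj orbT.
Qed.

Lemma Rd_sum_ord (p n : nat) (F : 'I_n -> rat) (G : 'I_n -> 'F_p) :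
  (forall i, Rd (F i) (G i)) -> Rd (\sum_i F i) (\sum_i G i).
Proof. by move=> h; apply: Rd_sum => i _. Qed.

Lemma Rd_fun (p : nat) (x : rat) (a b : 'F_p) : Rd x a -> Rd x b -> a = b.
Proof.
move=> [m [d [hd -> ->]]] [m' [d' [hd' + ->]]] => /eqP.
rewrite eqr_div ?(intr_neq0_Fp hd) ?(intr_neq0_Fp hd') // -!intrM eqr_int => /eqP e.
by apply/eqP; rewrite eqr_div // -!intrM e.
Qed.

Lemma Rd_pint (p : nat) (hp : prime p) (x : rat) (a : 'F_p) :
  Rd x a -> p_integral p x.
Proof.
move=> [m [d [hd hx _]]]; rewrite /p_integral.
have Hd := intr_neq0_Fp hd.
apply: contra hd; rewrite intr_Fp_eq0 // => hpx; apply: (dvdn_trans hpx).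
have e : numq x * d = m * denq x.
  apply/eqP; rewrite -(eqr_int rat) !intrM numqE hx; apply/eqP.
  by field.
have : (denq x %| numq x * d)%Z by rewrite e dvdz_mull.
by rewrite Gauss_dvdzr // coprimez_sym coprimezE coprime_num_den.
Qed.

Lemma pint_Rd (p : nat) (hp : prime p) (x : rat) :
  p_integral p x -> exists a : 'F_p, Rd x a.
Proof.
move=> h; exists ((numq x)%:~R / (denq x)%:~R), (numq x), (denq x).
by split; rewrite ?intr_Fp_eq0 ?divq_num_den.
Qed.

(** The way back from the field: an identity between residues becomes divisibility by p of a
    difference of rationals. *)
Lemma Rd0_divp (p : nat) (hp : prime p) (x : rat) :
  @Rd p x 0 -> exists2 y, p_integral p y & x = p%:R * y.
Proof.
move=> [m [d [hd -> /esym/eqP]]].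
rewrite mulf_eq0 invr_eq0 (negbTE hd) orbF intr_Fp_eq0 // => hm.
have /dvdzP[q ->] : (p %| m)%Z by [].
exists (q%:~R / d%:~R); last by rewrite intrM; ring.
by apply: (@Rd_pint p hp _ (q%:~R / d%:~R)); exists q, d.
Qed.

Lemma pint_add (p : nat) (hp : prime p) (x y : rat) :
  p_integral p x -> p_integral p y -> p_integral p (x + y).
Proof.
move=> /(pint_Rd hp)[a ha] /(pint_Rd hp)[b hb].
exact: (Rd_pint hp (Rd_add ha hb)).
Qed.

Lemma pint_mul (p : nat) (hp : prime p) (x y : rat) :
  p_integral p x -> p_integral p y -> p_integral p (x * y).
Proof.
move=> /(pint_Rd hp)[a ha] /(pint_Rd hp)[b hb].
exact: (Rd_pint hp (Rd_mul ha hb)).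
Qed.

Lemma pint_nat (p : nat) (hp : prime p) (n : nat) : p_integral p n%:R.
Proof. exact: (Rd_pint hp (Rd_nat p n)). Qed.

Lemma pint_opp (p : nat) (hp : prime p) (x : rat) :
  p_integral p x -> p_integral p (- x).
Proof.
move=> /(pint_Rd hp)[a ha]; exact: (Rd_pint hp (Rd_opp ha)).
Qed.

Lemma natr_Fp_eq0 (p : nat) (hp : prime p) (d : nat) :
  (d%:R == 0 :> 'F_p) = (p %| d)%N.
Proof. by rewrite (dvdn_pcharf (pchar_Fp hp)). Qed.

Lemma Rd_natV (p : nat) (hp : prime p) (d : nat) :
  ~~ (p %| d)%N -> @Rd p d%:R^-1 d%:R^-1.
Proof. by move=> h; apply: Rd_inv; [rewrite natr_Fp_eq0 | apply: Rd_nat]. Qed.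

Lemma pint_natV (p : nat) (hp : prime p) (d : nat) :
  ~~ (p %| d)%N -> p_integral p d%:R^-1.
Proof. by move=> h; apply: (Rd_pint hp (Rd_natV hp h)). Qed.

(** * Bernoulli polynomials over the prime field *)

Lemma poly_Fp_eq0 (p : nat) (hp : prime p) (q : {poly 'F_p}) :
  (size q <= p)%N -> (forall x, q.[x] = 0) -> q = 0.
Proof.
move=> hq h; apply/eqP; apply: contraLR hq => q0.
rewrite -ltnNge -{1}(card_Fp hp) cardE; apply: max_poly_roots => //.
  by apply/allP => x _; rewrite /root h.
exact: enum_uniq.
Qed.

(** The polynomial q - q(0) vanishes on the images of all natural numbers, hence at p points, too
    many for its size. *)
Lemma poly_Fp_periodic (p : nat) (hp : prime p) (q : {poly 'F_p}) :
  (size q <= p)%N -> (forall x, q.[x + 1] = q.[x]) -> q = (q.[0])%:P.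
Proof.
move=> hq h; apply/eqP; rewrite -subr_eq0; apply/eqP/(poly_Fp_eq0 hp).
  apply: leq_trans (size_polyD _ _) _; rewrite geq_max hq size_polyN.
  by apply: leq_trans (size_polyC_leq1 _) (prime_gt0 hp).
move=> x; rewrite hornerD hornerN hornerC -(natr_Zp x).
elim: (x : nat) => [|m IH]; first by rewrite subrr.
by rewrite -natr1 h.
Qed.

(** The Bernoulli polynomial B_N when [b] lists the Bernoulli numbers. *)
Definition bpoly (F : comNzRingType) (b : nat -> F) (N : nat) : {poly F} :=
  \poly_(j < N.+1) (b (N - j)%N *+ 'C(N, j)).

(** For k + j <= n both sides times k! j! (n-k-j)! equal n!; otherwise both vanish. *)
Lemma trinomial_revision (n k j : nat) :
  ('C(n, k) * 'C(n - k, j) = 'C(n, j) * 'C(n - j, k))%N.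
Proof.
case: (leqP (k + j)%N n) => h; last first.
  have z a b : (n < a + b)%N -> ('C(n, a) * 'C(n - a, b) = 0)%N.
    move=> hab; case: (leqP a n) => ha; last by rewrite bin_small.
    by rewrite ['C(n - a, b)]bin_small ?muln0 // ltn_subLR.
  by rewrite !z // addnC.
have f a b : (a + b <= n)%N ->
    ('C(n, a) * 'C(n - a, b) * (a`! * b`! * (n - a - b)`!) = n`!)%N.
  move=> hab.
  have ha : (a <= n)%N by apply: leq_trans hab; apply: leq_addr.
  rewrite -(bin_fact ha).
  have hb : (b <= n - a)%N by rewrite leq_subRL.
  by rewrite -(bin_fact hb); ring.
have h' : (j + k <= n)%N by rewrite addnC.
have := f _ _ h; rewrite -(f _ _ h') -!subnDA (addnC j k) (mulnC j`!) => /eqP.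
by rewrite eqn_pmul2r ?muln_gt0 ?fact_gt0 // => /eqP.
Qed.

Lemma sum_bin_widen (A : comNzRingType) (G : nat -> A) (i N : nat) : (i <= N)%N ->
  \sum_(j < i.+1) G j *+ 'C(i, j) = \sum_(j < N.+1) G j *+ 'C(i, j).
Proof.
move=> hi; rewrite (@big_ord_widen _ _ _ i.+1 N.+1 (fun j => G j *+ 'C(i, j))) //.
rewrite big_mkcond; apply: eq_bigr => j _.
by case: ifP => // /negbT; rewrite -leqNgt => h; rewrite bin_small.
Qed.

(** Expanding (x+1)^i and exchanging sums, trinomial revision turns the coefficient of x^j into
    C(N,j) times the sum in [hb] at m = N - j. *)
Lemma bpoly_shift (A : comNzRingType) (b : nat -> A) (N : nat) (x : A)
    (hb : forall m, (m <= N)%N ->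
       \sum_(k < m.+1) b k *+ 'C(m, k) = b m + (m == 1%N)%:R) :
  (bpoly b N).[x + 1] = (bpoly b N).[x] + x ^+ N.-1 *+ N.
Proof.
rewrite !horner_poly.
transitivity (\sum_(i < N.+1) \sum_(j < N.+1)
    x ^+ j * (b (N - i)%N *+ ('C(N, i) * 'C(i, j)))).
  apply: eq_bigr => i _; rewrite exprD1n.
  rewrite (sum_bin_widen (fun j => x ^+ j) (leq_ord i)) mulr_sumr.
  by apply: eq_bigr => j _; rewrite mulrnA !mulrnAr mulrnAl [x ^+ _ * _]mulrC.
rewrite exchange_big /=.
transitivity (\sum_(j < N.+1) (b (N - j)%N *+ 'C(N, j) * x ^+ j +
    (N - j == 1)%N%:R *+ 'C(N, j) * x ^+ j)).
  apply: eq_bigr => j _; rewrite -mulrDl -mulrnDl -mulr_sumr mulrC; congr (_ * _).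
  rewrite -hb ?leq_subr // (sum_bin_widen b (leq_subr j N)) -sumrMnl.
  rewrite (reindex_inj rev_ord_inj) /=; apply: eq_bigr => k _.
  rewrite subSS subKn ?leq_ord // bin_sub ?leq_ord // trinomial_revision.
  by rewrite mulnC mulrnA.
rewrite big_split /=; congr (_ + _).
(* The indicator survives only at j = N - 1. For N = 0 it never holds, and the right side has
   multiplicity 0. *)
case: N hb => [|N] hb; first by rewrite big_ord_recr big_ord0 /= mul0rn mul0r addr0.
rewrite big_ord_recr big_ord_recr /= subnn mul0rn mul0r addr0 big1 => [|i _].
  by rewrite add0r subSnn eqxx binSn mulr_natl.
have -> : (N.+1 - i == 1)%N = false.
  by apply/negbTE; rewrite subSn ?(ltnW (ltn_ord i)) // eqSS subn_eq0 -ltnNge.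
by rewrite mul0rn mul0r.
Qed.

Lemma bpoly_deriv (A : comNzRingType) (b : nat -> A) (N : nat) :
  (bpoly b N.+1)^`() = bpoly b N *+ N.+1.
Proof.
apply/polyP => i; rewrite coef_deriv coefMn !coef_poly ltnS.
case: ifP => h; last by rewrite !mul0rn.
by rewrite subSS -!mulrnA mulnC [in RHS]mulnC mul_bin_diag.
Qed.

Lemma bpoly0 (A : comNzRingType) (b : nat -> A) (N : nat) : (bpoly b N).[0] = b N.
Proof. by rewrite horner_coef0 coef_poly /= subn0 bin0. Qed.

Lemma size_bpoly (A : comNzRingType) (b : nat -> A) (N : nat) :
  (size (bpoly b N) <= N.+1)%N.
Proof. exact: size_poly. Qed.

(** * Bernoulli numbers and their residues *)

Lemma size_bern_seq (n : nat) : size (bern_seq n) = n.+1.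
Proof. by elim: n => //= n IH; rewrite size_rcons IH. Qed.

Lemma nth_bern_seq (n k : nat) : (k <= n)%N -> (bern_seq n)`_k = bernoulli k.
Proof.
elim: n => [|n IH]; first by rewrite leqn0 => /eqP ->.
rewrite leq_eqVlt => /predU1P[-> //|]; rewrite ltnS => hk.
by rewrite /= nth_rcons size_bern_seq ltnS hk IH.
Qed.

Lemma bernoulliS (n : nat) : bernoulli n.+1 =
  - (n.+2%:R^-1 * \sum_(k < n.+1) bernoulli k *+ 'C(n.+2, k)).
Proof.
rewrite /bernoulli /= nth_rcons size_bern_seq ltnn eqxx div1r mulNr.
congr (- (_ * _)); apply: eq_bigr => k _.
by rewrite nth_bern_seq ?leq_ord // mulr_natl.
Qed.

(** This is the hypothesis of [bpoly_shift]. The sum over k < m vanishes for m >= 2 by the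
    recurrence and for m = 0 because it is empty; for m = 1 it is B_0 = 1, whence the correction. *)
Lemma bernoulli_sum (m : nat) :
  \sum_(k < m.+1) bernoulli k *+ 'C(m, k) = bernoulli m + (m == 1%N)%:R.
Proof.
rewrite big_ord_recr /= binn mulr1n addrC; congr (_ + _).
case: m => [|[|n]]; first by rewrite big_ord0.
  by rewrite big_ord_recr big_ord0 /= add0r.
rewrite big_ord_recr /= bernoulliS; set S := \sum_(k < _) _.
rewrite binSn mulNrn -[X in _ - X]mulr_natl.
by rewrite mulrA divff ?mul1r ?subrr // pnatr_eq0.
Qed.

(** For p prime, [ratr] returns 0 when p divides the denominator; for k + 1 < p the value is the
    actual residue. *)
Definition bernFp (p k : nat) : 'F_p := ratr (bernoulli k).

Lemma Rd_ratr (p : nat) (x : rat) (a : 'F_p) : Rd x a -> ratr x = a.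
Proof.
move=> [m [d [hd hx ->]]]; have Hd := intr_neq0_Fp hd.
have e : numq x * d = m * denq x.
  apply/eqP; rewrite -(eqr_int rat) !intrM numqE hx; apply/eqP.
  by field.
have hd' : (denq x)%:~R != 0 :> 'F_p.
  have /dvdzP[q hq] : (denq x %| d)%Z.
    have : (denq x %| numq x * d)%Z by rewrite e dvdz_mull.
    by rewrite Gauss_dvdzr // coprimez_sym coprimezE coprime_num_den.
  by move: hd; rewrite hq intrM mulf_eq0 negb_or => /andP[].
by apply/eqP; rewrite /ratr eqr_div // -!intrM e.
Qed.

(** The recurrence for B_k divides only by k + 1, and B_k involves only earlier terms. *)
Lemma Rd_bernoulli (p : nat) (hp : prime p) (k : nat) :
  (k.+1 < p)%N -> Rd (bernoulli k) (bernFp p k).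
Proof.
elim/ltn_ind: k => k IH hk.
suff [a ha] : exists a : 'F_p, Rd (bernoulli k) a.
  by rewrite /bernFp (Rd_ratr ha).
case: k IH hk => [|k] IH hk; first by exists 1; apply: (Rd_nat p 1).
rewrite bernoulliS; eexists; apply/Rd_opp/Rd_mul.
  by apply: Rd_natV; rewrite // gtnNdvd.
apply: (@Rd_sum_ord p k.+1 _ (fun i => bernFp p i *+ 'C(k.+2, i))) => i.
apply: Rd_muln.
by apply: IH (ltn_ord i) _; apply: leq_trans hk; have := ltn_ord i; lia.
Qed.

Lemma bernFp_sum (p : nat) (hp : prime p) (m : nat) : (m.+1 < p)%N ->
  \sum_(k < m.+1) bernFp p k *+ 'C(m, k) = bernFp p m + (m == 1%N)%:R.
Proof.
move=> hm; apply: (Rd_fun (x := bernoulli m + (m == 1%N)%:R)).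
  rewrite -bernoulli_sum; apply: Rd_sum_ord => i.
  by apply/Rd_muln/Rd_bernoulli => //; have := ltn_ord i; lia.
by apply: Rd_add (Rd_nat _ _); apply: Rd_bernoulli.
Qed.

(* In degree less than [p] a polynomial over ['F_p] with no differences is constant, so [q] is
   a multiple of a shifted Bernoulli polynomial up to a constant. *)
Lemma deriv_of_diff (p : nat) (hp : prime p) (q : {poly 'F_p}) (N : nat) (c : 'F_p) :
  (size q <= p)%N -> (N.+2 < p)%N ->
  (forall x, q.[x + 1] - q.[x] = c * (x + 1) ^+ N *+ N.+1) ->
  q^`() = (c *+ N.+1) *: (bpoly (bernFp p) N \Po ('X + 1)).
Proof.
move=> hq hN h; pose B := bpoly (bernFp p) N.+1.
pose r := q - c *: (B \Po ('X + 1)).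
have hr : r = (r.[0])%:P.
  apply: (poly_Fp_periodic hp).
    apply: leq_trans (size_polyD _ _) _; rewrite geq_max hq size_polyN.
    apply: leq_trans (size_scale_leq _ _) _.
    by rewrite size_comp_poly2 ?size_XaddC // (leq_trans (size_bpoly _ _)) // ltnW.
  move=> y; rewrite /r !(hornerE, horner_comp).
  rewrite (bpoly_shift _ (b := bernFp p)) => [|m hm]; last first.
    by apply: bernFp_sum => //; apply: leq_ltn_trans hN.
  rewrite -/B; have /eqP := h y; rewrite subr_eq => /eqP ->; ring.
have : r^`() = 0 by rewrite hr derivC.
rewrite /r derivB derivZ deriv_comp bpoly_deriv derivD derivX derivC addr0 mulr1.
by move/eqP; rewrite subr_eq0 => /eqP ->; rewrite raddfMn /= -scalerMnl scalerMnr.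
Qed.

(** The duplication formula B_N(2x) = 2^(N-1) (B_N(x) + B_N(x + 1/2)) at x = 0. Its analogue in
    degree N + 1 holds up to a constant, both sides having the same differences, and is then
    differentiated. *)
Lemma bpoly_half (p : nat) (hp : prime p) (N : nat) :
  (2 < p)%N -> (N.+2 < p)%N ->
  bernFp p N *+ 2 = 2%:R ^+ N * (bernFp p N + (bpoly (bernFp p) N).[2%:R^-1]).
Proof.
move=> hp2 hN; pose B := bpoly (bernFp p) N.+1.
have h2 : 2%:R != 0 :> 'F_p by rewrite natr_Fp_eq0 // gtnNdvd.
have sB y : B.[y + 1] = B.[y] + y ^+ N *+ N.+1.
  apply: bpoly_shift => m hm; apply: bernFp_sum => //; exact: leq_ltn_trans hN.
pose r := B \Po (2%:R *: 'X) - 2%:R ^+ N *: (B + (B \Po ('X + (2%:R^-1)%:P))).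
have hr : r = (r.[0])%:P.
  apply: (poly_Fp_periodic hp).
    have sz : (size B <= p)%N by rewrite (leq_trans (size_bpoly _ _)) // ltnW.
    apply: leq_trans (size_polyD _ _) _; rewrite geq_max size_polyN; apply/andP; split.
      by rewrite size_comp_poly2 // size_scale ?size_polyX.
    rewrite (leq_trans (size_scale_leq _ _)) // (leq_trans (size_polyD _ _)) //.
    by rewrite geq_max sz size_comp_poly2 // size_XaddC.
  move=> y; rewrite /r !(hornerE, horner_comp) /=.
  have -> : 2%:R * (y + 1) = 2%:R * y + 1 + 1 :> 'F_p by ring.
  have -> : y + 1 + 2%:R^-1 = y + 2%:R^-1 + 1 :> 'F_p by ring.
  rewrite !sB.
  have -> : 2%:R * y + 1 = 2%:R * (y + 2%:R^-1) by rewrite mulrDr mulfV.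
  by rewrite !exprMn; ring.
have : r^`() = 0 by rewrite hr derivC.
move/(congr1 (horner^~ 0)); rewrite /r derivB derivZ derivD !deriv_comp bpoly_deriv.
rewrite derivZ derivD derivX derivC addr0 mulr1 horner0 !(hornerE, horner_comp) /=.
rewrite !hornerMn bpoly0 ?addr0 ?add0r => /eqP; rewrite subr_eq0 => /eqP e.
have hN1 : N.+1%:R != 0 :> 'F_p by rewrite natr_Fp_eq0 // gtnNdvd // ltnW.
apply: (mulIf hN1); move: e; move: (horner _ _) (bernFp p N) => u b e.
transitivity (b *+ N.+1 * 2%:R); first by ring.
by move: e; rewrite mulr1 => ->; ring.
Qed.

(** * The sums over the prime field *)

(** Stated for any commutative monoid because it pairs d with p - d both in harmonic sums and in the
    product [legR]. *)
Lemma big_fold (T : Type) (idx : T) (op : Monoid.com_law idx) (f : nat -> T) (n : nat) :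
  \big[op/idx]_(i < n.*2) f i.+1 =
  \big[op/idx]_(i < n) op (f i.+1) (f (n.*2.+1 - i.+1)%N).
Proof.
rewrite -addnn big_split_ord big_split /=; congr (op _ _).
rewrite (reindex_inj rev_ord_inj); apply: eq_bigr => i _ /=; congr f.
have := ltn_ord i; lia.
Qed.

(** For odd p = 2n + 1, the map d -> p - d sends the even d below p onto the odd ones. *)
Lemma big_even_odd (T : Type) (idx : T) (op : Monoid.com_law idx) (f : nat -> T)
    (n : nat) :
  \big[op/idx]_(i < n.*2) f i.+1 =
  \big[op/idx]_(i < n) op (f i.+1.*2) (f (n.*2.+1 - i.+1.*2)%N).
Proof.
rewrite big_split /=.
have -> : \big[op/idx]_(i < n) f (n.*2.+1 - i.+1.*2)%N =
          \big[op/idx]_(i < n) f i.*2.+1.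
  rewrite (reindex_inj rev_ord_inj); apply: eq_bigr => i _ /=; congr f.
  have := ltn_ord i; lia.
elim: n => [|n IH]; first by rewrite !big_ord0 Monoid.mul1m.
rewrite doubleS !big_ord_recr /= IH doubleS -!Monoid.mulmA; congr (op _ _).
by rewrite [RHS]Monoid.mulmC -!Monoid.mulmA.
Qed.

(** * Harmonic sums and the product [legR] modulo p *)

Definition invFp (p j : nat) : 'F_p := j%:R^-1.

Lemma invFpK (p : nat) (hp : prime p) (i : nat) : (i.+1 < p)%N ->
  i.+1%:R * invFp p i.+1 = 1.
Proof. by move=> hi; rewrite mulfV // natr_Fp_eq0 // gtnNdvd. Qed.

Lemma invFp_opp (p : nat) (hp : prime p) (d : nat) : (d <= p)%N ->
  invFp p (p - d) = - invFp p d.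
Proof.
move=> hd; rewrite /invFp natrB // (eqP (_ : p%:R == 0)) ?natr_Fp_eq0 //.
by rewrite sub0r invrN.
Qed.

(** The two pairings give H_(p-1)^(2) = 2 H_n^(2) and H_(p-1)^(2) = H_n^(2) / 2, so that 3 H_n^(2) =
    0. *)
Lemma hsum2_Fp (p n : nat) (hp : prime p) (hp3 : (3 < p)%N) (hn : p = n.*2.+1) :
  hsum (invFp p) 2 n = 0 /\ hsum (invFp p) 2 n.*2 = 0.
Proof.
have h2 : 2%:R != 0 :> 'F_p by rewrite natr_Fp_eq0 // gtnNdvd // ltnW.
have h3 : 3%:R != 0 :> 'F_p by rewrite natr_Fp_eq0 // gtnNdvd.
have hs d : (d <= p)%N -> invFp p (n.*2.+1 - d) ^+ 2 = invFp p d ^+ 2.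
  by move=> hd; rewrite -hn invFp_opp // sqrrN.
have e1 : hsum (invFp p) 2 n.*2 = hsum (invFp p) 2 n *+ 2.
  rewrite /hsum (big_fold _ (fun d => invFp p d ^+ 2)) -sumrMnl.
  apply: eq_bigr => i _; rewrite hs //; have := ltn_ord i; lia.
have e2 : hsum (invFp p) 2 n.*2 = hsum (invFp p) 2 n * 2%:R^-1.
  rewrite /hsum (big_even_odd _ (fun d => invFp p d ^+ 2)) mulr_suml.
  apply: eq_bigr => i _; rewrite hs; last by have := ltn_ord i; lia.
  rewrite /= /invFp -muln2 natrM invfM -mulr2n; move: (i.+1%:R^-1) => x; field.
  exact: h2.
have e : hsum (invFp p) 2 n = 0.
  apply: (mulfI h3); rewrite mulr0.
  have : hsum (invFp p) 2 n *+ 2 * 2%:R = hsum (invFp p) 2 n.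
    by rewrite -e1 e2 divfK.
  move: (hsum _ _ _) => x h.
  transitivity (x *+ 2 * 2%:R - x); first by ring.
  by rewrite h subrr.
by split=> //; rewrite e1 e mul0rn.
Qed.

(** Every nonzero residue is i or -i for some 1 <= i <= n, and the factor of that i vanishes. *)
Lemma legR_Fp_eq0 (p n : nat) (hp : prime p) (hn : p = n.*2.+1) (x : 'F_p) (N : nat) :
  x != 0 -> (n <= N)%N -> legR (invFp p) x N = 0.
Proof.
move=> hx hN.
suff [i hi [hip e]] : exists2 i, (i < n)%N & (i.+1 < p)%N /\ x ^+ 2 = i.+1%:R ^+ 2.
  have hi' := leq_trans hi hN.
  rewrite /legR (bigD1 (Ordinal hi')) //= e -exprMn invFpK //.
  by rewrite expr1n subrr mul0r.
have hxp : ((x : nat) < p)%N.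
  exact: (leq_trans (ltn_ord x) (eq_leq (Fp_cast hp))).
have hx0 : (0 < (x : nat))%N.
  by rewrite lt0n; apply: contra hx => /eqP h; rewrite -(natr_Zp x) h.
case: (leqP x n) => hxn.
  exists x.-1; rewrite prednK //; split=> //.
  by rewrite natr_Zp.
exists (p - x).-1; first by lia.
have hlt : (0 < p - x)%N by rewrite subn_gt0.
rewrite prednK //; split; first by lia.
rewrite natrB ?(ltnW hxp) // natr_Zp (eqP (_ : p%:R == 0)) ?natr_Fp_eq0 //.
by rewrite sub0r sqrrN.
Qed.

Lemma natr_p (p : nat) (hp : prime p) : p%:R = 0 :> 'F_p.
Proof. by apply/eqP; rewrite natr_Fp_eq0. Qed.

Lemma expFp (p : nat) (hp : prime p) (x : 'F_p) : x ^+ p = x.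
Proof. by rewrite -{2}(expf_card x) card_Fp. Qed.

(** By Fermat 2^(p-5) = 1/16, so duplication reads 2b = (b + u)/16, that is u = 31b. *)
Lemma bpoly_half5 (p : nat) (hp : prime p) (hp5 : (5 < p)%N) :
  (bpoly (bernFp p) (p - 5)).[2%:R^-1] = bernFp p (p - 5) * 31%:R.
Proof.
have h2 : 2%:R != 0 :> 'F_p by rewrite natr_Fp_eq0 // gtnNdvd //; lia.
have e : bernFp p (p - 5) *+ 2 = 2%:R ^+ (p - 5) *
    (bernFp p (p - 5) + (bpoly (bernFp p) (p - 5)).[2%:R^-1]).
  by apply: bpoly_half => //; lia.
have e2 : 2%:R ^+ (p - 5) * 2%:R ^+ 5 = 2%:R :> 'F_p.
  by rewrite -exprD subnK ?expFp // ltnW.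
move: e e2; move: (bernFp p (p - 5)) (horner _ _) (2%:R ^+ (p - 5)) => b u w e e2.
apply: (mulfI h2).
transitivity (w * 2%:R ^+ 5 * (b + u) - 2%:R * b); first by rewrite e2; ring.
transitivity (w * (b + u) * 2%:R ^+ 5 - 2%:R * b); first by ring.
by rewrite -e; ring.
Qed.

Lemma half_Fp (p n : nat) (hp : prime p) (hp2 : (2 < p)%N) (hn : p = n.*2.+1) :
  n%:R + 1 = 2%:R^-1 :> 'F_p.
Proof.
have h2 : 2%:R != 0 :> 'F_p by rewrite natr_Fp_eq0 // gtnNdvd.
apply: (mulfI h2); rewrite mulfV //.
have : n.*2.+1%:R = 0 :> 'F_p by apply/eqP; rewrite natr_Fp_eq0 // -hn.
rewrite -natr1 -muln2 natrM => h.
transitivity (n%:R * 2%:R + 1 + 1 : 'F_p); first by ring.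
by rewrite h add0r.
Qed.

(** In the field B_(p-5)(x+1) - B_(p-5)(x) = -5 x^(p-6), and x^(p-6) = x^(-5) for x nonzero. Summing
    over 1 <= x <= n, where n + 1 = 1/2, gives 31b - b = -5 H_n^(5). *)
Lemma hsum5_Fp (p n : nat) (hp : prime p) (hp5 : (5 < p)%N) (hn : p = n.*2.+1) :
  hsum (invFp p) 5 n = - (bernFp p (p - 5) * 6%:R).
Proof.
have h5 : 5%:R != 0 :> 'F_p by rewrite natr_Fp_eq0 // gtnNdvd.
pose B := bpoly (bernFp p) (p - 5).
have sB x : B.[x + 1] = B.[x] - 5%:R * x ^+ (p - 6).
  rewrite /B bpoly_shift => [|m hm]; last by apply: bernFp_sum => //; lia.
  have -> : (p - 5).-1 = (p - 6)%N by lia.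
  rewrite -[X in _ + X]mulr_natl natrB ?natr_p ?sub0r ?mulNr //; lia.
have inv5 i : (i.+1 < p)%N -> i.+1%:R ^+ (p - 6) = invFp p i.+1 ^+ 5.
  move=> hi; have hi0 := invFpK hp hi.
  have -> : i.+1%:R ^+ (p - 6) =
      i.+1%:R ^+ (p - 6) * (i.+1%:R * invFp p i.+1) ^+ 6 :> 'F_p.
    by rewrite hi0 expr1n mulr1.
  have e : i.+1%:R ^+ (p - 6) * i.+1%:R ^+ 6 = i.+1%:R :> 'F_p.
    by rewrite -exprD subnK ?expFp.
  by rewrite exprMn mulrA e exprS mulrA hi0 mul1r.
have sumB m : (m < p)%N -> B.[m%:R + 1] = B.[1] - 5%:R * hsum (invFp p) 5 m.
  elim: m => [|m IH] hm; first by rewrite /hsum big_ord0 mulr0 subr0 add0r.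
  rewrite sB -[in B.[_]]natr1 IH ?(ltnW hm) // inv5 //.
  by rewrite /hsum big_ord_recr /=; ring.
have B1 : B.[1] = bernFp p (p - 5).
  (* B(1) = B(0) because 0^(p-6) = 0: the exponent is nonzero, p being odd. *)
  rewrite -[X in B.[X]]add0r sB bpoly0 expr0n; case: eqP; last by rewrite mulr0 subr0.
  lia.
have hn1 := half_Fp hp (ltnW (ltnW (ltnW hp5))) hn.
have hnp : (n < p)%N by lia.
have := sumB n hnp; rewrite hn1 B1 bpoly_half5 //; move => e; apply: (mulfI h5); move: e.
move: (hsum _ _ _) (bernFp _ _) => H b e.
transitivity (b - (b - 5%:R * H)); first by ring.
by rewrite -e; ring.
Qed.

(* [- legE c v] is the derivative of [legP c] at [v], and [legQ] the second-order remainder. *)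
Fixpoint legE (A : comNzRingType) (c : nat -> A) (v : A) (k : nat) : A :=
  if k is i.+1 then
    (legE c v i * (i%:R * i.+1%:R - v) + legP c v i) * c i.+1 ^+ 2
  else 0.

Fixpoint legQ (A : comNzRingType) (c : nat -> A) (v u : A) (k : nat) : A :=
  if k is i.+1 then
    (legQ c v u i * (i%:R * i.+1%:R - v - u) + legE c v i) * c i.+1 ^+ 2
  else 0.

#[global] Arguments legE : simpl never.
#[global] Arguments legQ : simpl never.

Lemma legES (A : comNzRingType) (c : nat -> A) (v : A) (k : nat) :
  legE c v k.+1 = (legE c v k * (k%:R * k.+1%:R - v) + legP c v k) * c k.+1 ^+ 2.
Proof. by []. Qed.

Lemma legQS (A : comNzRingType) (c : nat -> A) (v u : A) (k : nat) :
  legQ c v u k.+1 =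
  (legQ c v u k * (k%:R * k.+1%:R - v - u) + legE c v k) * c k.+1 ^+ 2.
Proof. by []. Qed.

Definition legFE (A : comNzRingType) (c : nat -> A) (v : A) (N : nat) : A :=
  \sum_(k < N) hsum c 2 k.+1 * c k.+1 * legE c v k.+1.

Definition legFQ (A : comNzRingType) (c : nat -> A) (v u : A) (N : nat) : A :=
  \sum_(k < N) hsum c 2 k.+1 * c k.+1 * legQ c v u k.+1.

Lemma legPS (A : comNzRingType) (c : nat -> A) (v : A) (k : nat) :
  legP c v k.+1 = legP c v k * ((k%:R * k.+1%:R - v) * c k.+1 ^+ 2).
Proof. by rewrite /legP big_ord_recr. Qed.

Lemma legP_taylor (A : comNzRingType) (c : nat -> A) (v u : A) (k : nat) :
  legP c (v + u) k = legP c v k - u * legE c v k + u ^+ 2 * legQ c v u k.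
Proof.
elim: k => [|k IH]; first by rewrite /legP !big_ord0 /legE /legQ; ring.
by rewrite !legPS IH legES legQS; ring.
Qed.

(** Used over polynomials with u = (X + 1/2)^2, where a second derivative reads off the linear
    coefficient, and over the rationals with u = p^2/4, where the last term is 0 modulo p^3. *)
Lemma legF_taylor (A : comNzRingType) (c : nat -> A) (v u : A) (N : nat) :
  legF c (v + u) N = legF c v N - u * legFE c v N + u ^+ 2 * legFQ c v u N.
Proof.
rewrite /legF /legFE /legFQ !mulr_sumr -sumrB -big_split /=.
by apply: eq_bigr => k _; rewrite legP_taylor /=; ring.
Qed.

(** * Transfer along ring morphisms, and degree bounds *)

Lemma hsum_rmorph (A B : comNzRingType) (f : {rmorphism A -> B}) (c : nat -> A)
    (c' : nat -> B) (hc : forall i, f (c i) = c' i) (r N : nat) :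
  f (hsum c r N) = hsum c' r N.
Proof. by rewrite rmorph_sum; apply: eq_bigr => i _; rewrite rmorphXn /= hc. Qed.

Lemma legP_rmorph (A B : comNzRingType) (f : {rmorphism A -> B}) (c : nat -> A)
    (c' : nat -> B) (hc : forall i, f (c i) = c' i) (v : A) (k : nat) :
  f (legP c v k) = legP c' (f v) k.
Proof.
rewrite rmorph_prod; apply: eq_bigr => i _.
by rewrite rmorphM rmorphB rmorphM !rmorph_nat rmorphXn /= hc.
Qed.

Lemma legE_rmorph (A B : comNzRingType) (f : {rmorphism A -> B}) (c : nat -> A)
    (c' : nat -> B) (hc : forall i, f (c i) = c' i) (v : A) (k : nat) :
  f (legE c v k) = legE c' (f v) k.
Proof.
elim: k => [|k IH]; first by rewrite /legE rmorph0.
rewrite !legES rmorphM rmorphD rmorphM rmorphB rmorphM !rmorph_nat rmorphXn /= hc IH.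
by rewrite (legP_rmorph hc).
Qed.

Lemma legF_rmorph (A B : comNzRingType) (f : {rmorphism A -> B}) (c : nat -> A)
    (c' : nat -> B) (hc : forall i, f (c i) = c' i) (v : A) (N : nat) :
  f (legF c v N) = legF c' (f v) N.
Proof.
rewrite rmorph_sum; apply: eq_bigr => i _.
by rewrite !rmorphM /= hc (hsum_rmorph hc) (legP_rmorph hc).
Qed.

Lemma legFE_rmorph (A B : comNzRingType) (f : {rmorphism A -> B}) (c : nat -> A)
    (c' : nat -> B) (hc : forall i, f (c i) = c' i) (v : A) (N : nat) :
  f (legFE c v N) = legFE c' (f v) N.
Proof.
rewrite rmorph_sum; apply: eq_bigr => i _.
by rewrite rmorphM rmorphM hc (hsum_rmorph hc) (legE_rmorph hc).
Qed.

Lemma size_legP (F : fieldType) (c : nat -> F) (k : nat) :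
  (size (legP (fun j => (c j)%:P) ('X * ('X + 1)) k) <= k.*2.+1)%N.
Proof.
elim: k => [|k IH]; first by rewrite /legP big_ord0 size_poly1.
rewrite legPS; apply: leq_trans (size_polyMleq _ _) _.
suff h : (size ((k%:R * k.+1%:R - 'X * ('X + 1)) * (c k.+1)%:P ^+ 2)%R <= 3)%N.
  by rewrite -subn1 leq_subLR doubleS; apply: leq_trans (leq_add IH h) _; lia.
have -> : (k%:R * k.+1%:R - 'X * ('X + 1)) * (c k.+1)%:P ^+ 2 =
    (c k.+1 ^+ 2) *: ((k%:R * k.+1%:R)%:P - 'X * ('X + 1%:P)) :> {poly F}.
  by rewrite -mul_polyC polyCM !polyCMn polyC_exp; ring.
apply: leq_trans (size_scale_leq _ _) _; apply: leq_trans (size_polyD _ _) _.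
rewrite geq_max size_polyN; apply/andP; split.
  exact: leq_trans (size_polyC_leq1 _) _.
by apply: leq_trans (size_polyMleq _ _) _; rewrite size_polyX size_XaddC.
Qed.

Lemma size_legF (F : fieldType) (c : nat -> F) (N : nat) :
  (size (legF (fun j => (c j)%:P) ('X * ('X + 1)) N) <= N.*2.+1)%N.
Proof.
apply: leq_trans (size_sum _ _ _) _; apply/bigmax_leqP => k _.
have -> : hsum (fun j => (c j)%:P) 2 k.+1 = (hsum c 2 k.+1)%:P :> {poly F}.
  by rewrite (hsum_rmorph (f := polyC) (c' := fun j => (c j)%:P)).
rewrite -polyCM mul_polyC; apply: leq_trans (size_scale_leq _ _) _.
by apply: leq_trans (size_legP _ _) _; rewrite ltnS leq_double.
Qed.

(** Every other Leibniz term keeps a factor X + h, which vanishes at -h. *)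
Lemma deriv2_sqr (A : comNzRingType) (h : A) (g : {poly A}) :
  (('X + h%:P) ^+ 2 * g)^`()^`().[- h] = g.[- h] *+ 2.
Proof.
have hL : ('X + h%:P)^`() = 1 :> {poly A} by rewrite derivD derivX derivC addr0.
have hL0 : ('X + h%:P).[- h] = 0 by rewrite !hornerE addNr.
rewrite expr2; move: ('X + h%:P) hL hL0 => L hL hL0.
rewrite !(derivM, derivD, hL, hornerD, hornerM, hL0, mulr0, mul0r, addr0, add0r).
by rewrite ?hornerE; ring.
Qed.

(** * The head as a polynomial over the prime field *)

Definition legFp (p N : nat) : {poly 'F_p} :=
  legF (fun j => (invFp p j)%:P) ('X * ('X + 1)) N.

Lemma horner_legFp (p N : nat) (x : 'F_p) :
  (legFp p N).[x] = legF (invFp p) (x * (x + 1)) N.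
Proof.
rewrite /legFp -[LHS]/(horner_eval x _).
rewrite (legF_rmorph (c' := invFp p)) => [|i]; last exact: hornerC.
by rewrite /= /horner_eval !hornerE.
Qed.

(** For z = x + 1 nonzero, R_n(z) = 0 and the telescoping identity leaves -2 = -2 z^(p-1) on the
    right. *)
Lemma legFp_diff (p n : nat) (hp : prime p) (hp5 : (5 < p)%N) (hn : p = n.*2.+1)
    (x : 'F_p) :
  (legFp p n).[x + 1] - (legFp p n).[x] = - ((x + 1) ^+ (p - 4) *+ 2).
Proof.
rewrite !horner_legFp; have -> : x * (x + 1) = (x + 1 - 1) * (x + 1) by ring.
move: (x + 1) => {x} z.
(* The factor z^3 makes the identity empty at z = 0, but there z(z+1) and (z-1)z coincide. *)
have [->|hz] := eqVneq z 0.
  rewrite !(mul0r, mulr0) subrr expr0n; case: eqP; last by rewrite mul0rn oppr0.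
  lia.
apply: (mulfI (expf_neq0 3 hz)).
rewrite legF_diff; last by move=> i hi; apply: invFpK => //; lia.
rewrite (legR_Fp_eq0 hp hn hz (leqnn n)) mul0r sub0r mulrN mulrnAr -exprD.
have -> : (3 + (p - 4) = p.-1)%N by lia.
have : z ^+ p.-1 = 1 by apply: (mulfI hz); rewrite -exprS prednK ?prime_gt0 // expFp ?mulr1.
by move=> ->; rewrite mulNrn.
Qed.

Lemma half_sqr_poly (p : nat) (hp : prime p) (hp2 : (2 < p)%N) :
  'X * ('X + 1) = (- 4%:R^-1)%:P + ('X + (2%:R^-1)%:P) ^+ 2 :> {poly 'F_p}.
Proof.
have h2 : 2%:R != 0 :> 'F_p by rewrite natr_Fp_eq0 // gtnNdvd.
have h4 : 4%:R != 0 :> 'F_p by rewrite (natrM _ 2 2) mulf_neq0.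
set h : 'F_p := 2%:R^-1.
have e4 : (4%:R^-1)%:P = h%:P ^+ 2.
  by rewrite -polyC_exp /h; congr _%:P; field; apply/andP.
have e2 : h%:P *+ 2 = 1.
  by rewrite -polyCMn -mulr_natl mulfV.
rewrite polyCN e4; transitivity ('X * 'X + 'X * (h%:P *+ 2)); last by ring.
by rewrite e2; ring.
Qed.

(** The second derivative of F_n at -1/2 is -2 [legFE] by the Taylor expansion in (z + 1/2)^2. It is
    also 8 B_(p-5)(1/2) = 248b, as the differences of F_n make it a Bernoulli polynomial. *)
Lemma legFE_Fp (p n : nat) (hp : prime p) (hp5 : (5 < p)%N) (hn : p = n.*2.+1) :
  legFE (invFp p) (- 4%:R^-1) n = - (bernFp p (p - 5) * 124%:R).
Proof.
have h2 : 2%:R != 0 :> 'F_p by rewrite natr_Fp_eq0 // gtnNdvd //; lia.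
have h3 : 3%:R != 0 :> 'F_p by rewrite natr_Fp_eq0 // gtnNdvd //; lia.
set h : 'F_p := 2%:R^-1.
pose c := fun j => (invFp p j)%:P.
pose L : {poly 'F_p} := 'X + h%:P.
have hv : 'X * ('X + 1) = (- 4%:R^-1)%:P + L ^+ 2 :> {poly 'F_p}.
  by apply: half_sqr_poly; lia.
have d2 : (legFp p n)^`()^`().[- h] = legFE (invFp p) (- 4%:R^-1) n *- 2.
  rewrite /legFp -/c hv legF_taylor.
  have -> : legF c (- 4%:R^-1)%:P n = (legF (invFp p) (- 4%:R^-1) n)%:P.
    by rewrite (legF_rmorph (f := polyC) (c' := c)).
  have -> : legFE c (- 4%:R^-1)%:P n = (legFE (invFp p) (- 4%:R^-1) n)%:P.
    by rewrite (legFE_rmorph (f := polyC) (c' := c)).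
  set a := legFE (invFp p) _ n; set q := legFQ _ _ _ _.
  have -> : L ^+ 2 ^+ 2 * q = L ^+ 2 * (L ^+ 2 * q) by rewrite mulrA -expr2.
  rewrite -addrA -mulrN -mulrDr derivD derivC add0r deriv2_sqr.
  by rewrite !hornerE addNr expr0n mul0r addr0 mulNrn.
(* The constant is 2/3 because p - 3 = -3 in the field, so that (2/3)(p - 3) = -2. *)
have E : (legFp p n)^`() = (2%:R / 3%:R *+ (p - 5).+2) *:
    (bpoly (bernFp p) (p - 5).+1 \Po ('X + 1)).
  apply: (deriv_of_diff hp); [|lia|move=> x].
    by apply: leq_trans (size_legF _ _) _; rewrite -hn.
  rewrite (legFp_diff hp hp5 hn).
  have -> : (p - 4 = (p - 5).+1)%N by lia.
  have -> : (p - 5).+2 = (p - 3)%N by lia.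
  rewrite -mulr_natr -[in RHS]mulr_natr natrB ?natr_p ?(ltnW hp5) //; last by lia.
  by move: (_ ^+ _) => y; field.
have := d2; rewrite E derivZ deriv_comp bpoly_deriv derivD derivX derivC addr0 mulr1.
rewrite !(hornerE, horner_comp) hornerMn.
have -> : - h + 1 = h by rewrite /h; field.
rewrite bpoly_half5 //.
have -> : (p - 5).+2 = (p - 3)%N by lia.
have -> : (p - 5).+1 = (p - 4)%N by lia.
rewrite -[_ *+ (p - 3)]mulr_natr -[_ *+ (p - 4)]mulr_natr !natrB ?natr_p //; [|lia..].
move: (legFE _ _ _) (bernFp _ _) => a b e.
have h22 : 2%:R * 3%:R != 0 :> 'F_p by rewrite mulf_neq0.
apply: (mulfI h2); transitivity (- (a *- 2)); first by ring.
by rewrite -e; field.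
Qed.

(* [legP] without its factor [i = n], which vanishes modulo [p] to second order at [z = -1/2]. *)
Definition legT (A : comNzRingType) (c : nat -> A) (v : A) (n k : nat) : A :=
  \prod_(i < k | i != n :> nat) (i%:R * i.+1%:R - v) * \prod_(i < k) c i.+1 ^+ 2.

Definition legTsum (A : comNzRingType) (c : nat -> A) (v : A) (n N : nat) : A :=
  \sum_(k < N | (n <= k)%N) hsum c 2 k.+1 * c k.+1 * legT c v n k.+1.

Lemma legP_legT (A : comNzRingType) (c : nat -> A) (v : A) (n k : nat) : (n < k)%N ->
  legP c v k = (n%:R * n.+1%:R - v) * legT c v n k.
Proof.
move=> hn; rewrite /legP /legT big_split mulrA; congr (_ * _).
by rewrite (bigD1 (Ordinal hn)).
Qed.

Lemma legF_tail (A : comNzRingType) (c : nat -> A) (v : A) (n N : nat) : (n <= N)%N ->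
  legF c v N - legF c v n =
  \sum_(k < N | (n <= k)%N) hsum c 2 k.+1 * c k.+1 * legP c v k.+1.
Proof.
move=> hn; rewrite /legF (bigID (fun k : 'I_N => (n <= k)%N)) /=.
rewrite (big_ord_widen _ (fun k => hsum c 2 k.+1 * c k.+1 * legP c v k.+1) hn).
rewrite [X in _ + X - _](eq_bigl (fun k : 'I_N => (k < n)%N)) ?addrK // => k.
by rewrite -ltnNge.
Qed.

(** Every tail term contains the factor of index n; at v = -1/4 it is n(n+1) + 1/4 = p^2/4, the
    source of p^2 in the tail. *)
Lemma legF_legT (A : comNzRingType) (c : nat -> A) (v : A) (n N : nat) : (n <= N)%N ->
  legF c v N - legF c v n = (n%:R * n.+1%:R - v) * legTsum c v n N.
Proof.
move=> hn; rewrite legF_tail // mulr_sumr; apply: eq_bigr => k hk.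
have hk' : (n < k.+1)%N by [].
by rewrite (legP_legT _ _ hk') mulrCA.
Qed.

Lemma legTsum_rmorph (A B : comNzRingType) (f : {rmorphism A -> B}) (c : nat -> A)
    (c' : nat -> B) (hc : forall i, f (c i) = c' i) (v : A) (n N : nat) :
  f (legTsum c v n N) = legTsum c' (f v) n N.
Proof.
rewrite rmorph_sum; apply: eq_bigr => k _.
rewrite rmorphM rmorphM hc (hsum_rmorph hc); congr (_ * _).
rewrite rmorphM !rmorph_prod; congr (_ * _); apply: eq_bigr => i _.
  by rewrite rmorphB rmorphM !rmorph_nat.
by rewrite rmorphXn /= hc.
Qed.

(** Both sides have size at most p, equal 1 at 0 and vanish at every nonzero residue. *)
Lemma legR_Fp (p n : nat) (hp : prime p) (hn : p = n.*2.+1) :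
  legR (fun j => (invFp p j)%:P) 'X n = 1 - 'X^(p.-1).
Proof.
apply/eqP; rewrite -subr_eq0; apply/eqP/(poly_Fp_eq0 hp) => [|x].
  apply: leq_trans (size_polyD _ _) _; rewrite geq_max size_polyN; apply/andP; split.
    suff : (size (legR (fun j => (invFp p j)%:P) 'X n) <= n.*2.+1)%N.
      by move=> h; apply: leq_trans h _; rewrite -hn.
    rewrite /legR; elim: (n) => [|m IH]; first by rewrite big_ord0 size_poly1.
    rewrite big_ord_recr /=; apply: leq_trans (size_polyMleq _ _) _.
    have h : (size (1 - 'X ^+ 2 * (invFp p m.+1)%:P ^+ 2)%R <= 3)%N.
      apply: leq_trans (size_polyD _ _) _.
      rewrite geq_max size_poly1 size_polyN -polyC_exp mulrC mul_polyC /=.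
      by apply: leq_trans (size_scale_leq _ _) _; rewrite size_polyXn.
    by rewrite -subn1 leq_subLR doubleS; apply: leq_trans (leq_add IH h) _; lia.
  apply: leq_trans (size_polyD _ _) _; rewrite geq_max size_poly1 size_polyN.
  by rewrite size_polyXn (prednK (prime_gt0 hp)) leqnn (prime_gt0 hp).
have -> : (legR (fun j => (invFp p j)%:P) 'X n - (1 - 'X^(p.-1))).[x] =
    legR (invFp p) x n - (1 - x ^+ p.-1).
  rewrite hornerD hornerN; congr (_ - _); last by rewrite !hornerE.
  by rewrite /legR horner_prod; apply: eq_bigr => i _; rewrite !hornerE.
have hp0 := prime_gt0 hp.
have [->|hx] := eqVneq x 0.
  rewrite /legR big1 => [|i _]; last by rewrite expr0n mul0r subr0.
  rewrite expr0n; case: eqP => [h|_]; last by rewrite subr0 subrr.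
  by have := prime_gt1 hp; lia.
rewrite (legR_Fp_eq0 hp hn hx (leqnn n)) sub0r.
have -> : x ^+ p.-1 = 1 by apply: (mulfI hx); rewrite -exprS prednK // expFp ?mulr1.
by rewrite subrr oppr0.
Qed.

Lemma legR_Fp_double (p n : nat) (hp : prime p) (hn : p = n.*2.+1) :
  legR (fun j => (invFp p j)%:P) 'X n.*2 = (1 - 'X^(p.-1)) ^+ 2.
Proof.
rewrite -(legR_Fp hp hn) /legR.
rewrite (big_fold _ (fun d => 1 - 'X ^+ 2 * (invFp p d)%:P ^+ 2)) -prodrXl.
apply: eq_bigr => i _; rewrite -hn invFp_opp //; last by have := ltn_ord i; lia.
by rewrite /= polyCN sqrrN -expr2.
Qed.

(** * The tail as a polynomial over the prime field *)

Definition tailFp (p n : nat) : {poly 'F_p} := legFp p n.*2 - legFp p n.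

(** Subtract the telescoping identities for N = p - 1 and N = n, where H_N^(2) = 0, and cancel X^3.
    The identity is one of polynomials, since the degree may exceed p and the identity is
    differentiated later. *)
Lemma tailFp_diff (p n : nat) (hp : prime p) (hp5 : (5 < p)%N) (hn : p = n.*2.+1) :
  tailFp p n - (tailFp p n \Po ('X - 1)) = ('X^(p - 4) * ('X^(p.-1) - 1)) *+ 2.
Proof.
pose c := fun j => (invFp p j)%:P.
have hc : forall i, (i < n.*2)%N -> i.+1%:R * c i.+1 = 1.
  by move=> i hi; rewrite /c -polyC_natr -polyCM invFpK // hn.
have hc' : forall i, (i < n)%N -> i.+1%:R * c i.+1 = 1.
  by move=> i hi; apply: hc; lia.
have hs N : hsum (invFp p) 2 N = 0 -> hsum c 2 N = 0.
  by move=> h; rewrite -(hsum_rmorph (f := polyC) (c := invFp p)) // h.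
have [h1 h2] := hsum2_Fp hp (ltnW (ltnW hp5)) hn.
have comp N : legFp p N \Po ('X - 1) = legF c (('X - 1) * 'X) N.
  rewrite -[LHS]/(comp_poly ('X - 1) _) (legF_rmorph (c' := c)) => [|i]; last first.
    exact: comp_polyC.
  by rewrite /= rmorphM rmorphD /= comp_polyX -polyC1 comp_polyC subrK.
have hX : 'X ^+ 3 != 0 :> {poly 'F_p} by rewrite expf_neq0 ?polyX_eq0.
apply: (mulfI hX); rewrite /tailFp comp_polyB !comp.
transitivity ('X ^+ 3 * (legF c ('X * ('X + 1)) n.*2 - legF c (('X - 1) * 'X) n.*2)
  - 'X ^+ 3 * (legF c ('X * ('X + 1)) n - legF c (('X - 1) * 'X) n)).
  by rewrite /legFp -/c; ring.
rewrite !legF_diff // !hs // (legR_Fp hp hn) (legR_Fp_double hp hn).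
rewrite mulr0 add0r !mulr1.
have e : 'X^(p.-1) = 'X ^+ 3 * 'X^(p - 4) :> {poly 'F_p}.
  by rewrite -exprD; congr ('X^_); lia.
transitivity (('X^(p.-1) * ('X^(p.-1) - 1)) *+ 2 : {poly 'F_p}); first by ring.
by rewrite {1}e; ring.
Qed.

Lemma tailFp_root (p n : nat) (hp : prime p) (hn : p = n.*2.+1) (x : 'F_p) :
  (tailFp p n).[x] = 0.
Proof.
rewrite /tailFp hornerD hornerN !horner_legFp legF_tail; last by rewrite -addnn leq_addr.
apply: big1 => k hk; rewrite legP_legR => [|i hi]; last first.
  by apply: invFpK => //; have := ltn_ord k; lia.
have [->|hx] := eqVneq x 0; first by rewrite !(oppr0, mul0r, mulr0).
by rewrite (legR_Fp_eq0 hp hn hx hk) !mulr0.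
Qed.

(** The exponents 2p - 5 and p - 4 become -5 and -4, and y^(2p-6) = y^(p-5) by Fermat, leaving 2(-5
    + 4) y^(p-5). *)
Lemma deriv_tailFp_diff (p : nat) (hp : prime p) (hp5 : (5 < p)%N) (y : 'F_p) :
  (('X^(p - 4) * ('X^(p.-1) - 1)) *+ 2)^`().[y] = - (y ^+ (p - 5) *+ 2).
Proof.
have -> : 'X^(p - 4) * ('X^(p.-1) - 1) = 'X^(p - 4 + p.-1) - 'X^(p - 4) :> {poly 'F_p}.
  by rewrite mulrBr mulr1 exprD.
rewrite derivMn derivB !derivXn hornerMn hornerD hornerN !hornerMn !hornerXn.
have -> : (p - 4).-1 = (p - 5)%N by lia.
have -> : (p - 4 + p.-1).-1 = (p - 6 + p)%N by lia.
have -> : (p - 4 + p.-1)%N = (p + p - 5)%N by lia.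
have -> : y ^+ (p - 6 + p) = y ^+ (p - 5).
  rewrite exprD expFp // -exprSr; congr (y ^+ _); lia.
move: (y ^+ (p - 5)) => u.
rewrite -[u *+ (p + p - 5)]mulr_natr -[u *+ (p - 4)]mulr_natr !natrB ?natrD ?natr_p //.
- by ring.
- by lia.
by lia.
Qed.

(** The second derivative of the tail at -1/2 is -2 [legTsum], from the double zero there, and also
    -2V'(-1/2), where V is the quotient by X^p - X. The differences of V give V'(-1/2) = 2
    B_(p-5)(1/2) = 62b. *)
Lemma legTsum_Fp (p n : nat) (hp : prime p) (hp5 : (5 < p)%N) (hn : p = n.*2.+1) :
  legTsum (invFp p) (- 4%:R^-1) n n.*2 = bernFp p (p - 5) * 62%:R.
Proof.
have h2 : 2%:R != 0 :> 'F_p by rewrite natr_Fp_eq0 // gtnNdvd //; lia.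
have h4 : 4%:R != 0 :> 'F_p by rewrite natr_Fp_eq0 // gtnNdvd //; lia.
have hp2 : (2 < p)%N by lia.
set h : 'F_p := 2%:R^-1.
pose c := fun j => (invFp p j)%:P; pose t := tailFp p n.
pose V := t %/ ('X^p - 'X).
have genP : 'X^p - 'X = \prod_x ('X - x%:P) :> {poly 'F_p}.
  by rewrite -finField_genPoly card_Fp.
have tV : t = ('X^p - 'X) * V.
  rewrite mulrC divpK // genP -[\prod_x _]big_enum.
  apply: uniq_roots_dvdp; last by rewrite uniq_rootsE enum_uniq.
  by apply/allP => x _; apply/rootP/tailFp_root.
have dP : ('X^p - 'X)^`() = - 1 :> {poly 'F_p}.
  by rewrite derivB derivXn derivX -mulr_natr -polyC_natr natr_p // mulr0 sub0r.
have hP x : ('X^p - 'X : {poly 'F_p}).[x] = 0 by rewrite !hornerE expFp // subrr.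
(* On the field X^p - X vanishes and its derivative is -1, so t' = -V and t'' = -2V' as
   functions. *)
have t' : t^`() = ('X^p - 'X) * V^`() - V by rewrite tV derivM dP; ring.
have t'E x : t^`().[x] = - V.[x].
  by rewrite t' hornerD hornerM hP mul0r add0r hornerN.
have t''E x : t^`()^`().[x] = - V^`().[x] *+ 2.
  rewrite t' derivB derivM dP hornerD hornerN hornerD !hornerM hP hornerN hornerC; ring.
have szV : (size V <= p)%N.
  rewrite size_divp; last first.
    by rewrite genP; apply/monic_neq0/monic_prod_XsubC.
  have -> : size ('X^p - 'X : {poly 'F_p}) = p.+1.
    by rewrite genP -[\prod_x _]big_enum size_prod_XsubC -cardE card_Fp.
  have : (size t <= n.*2.*2.+1)%N.
    apply: leq_trans (size_polyD _ _) _; rewrite geq_max size_polyN; apply/andP; split.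
      exact: size_legF.
    by apply: leq_trans (size_legF _ _) _; rewrite ltnS leq_double -addnn leq_addr.
  by move=> /= hs; rewrite leq_subLR; apply: leq_trans hs _; lia.
(* The constant -1/2 is chosen so that, with p - 4 = -4, the difference is 2(x+1)^(p-5). *)
have Vdiff x : V.[x + 1] - V.[x] = (- 2%:R^-1) * (x + 1) ^+ (p - 5) *+ (p - 5).+1.
  have hX1 : ('X - 1)^`() = 1 :> {poly 'F_p} by rewrite derivB derivX derivC subr0.
  have /(congr1 (fun q => q^`().[x + 1])) := tailFp_diff hp hp5 hn.
  rewrite -/t derivB deriv_comp hX1 mulr1 deriv_tailFp_diff //.
  rewrite hornerD hornerN horner_comp t'E hornerD hornerN hornerX hornerC addrK t'E.
  have -> : (p - 5).+1 = (p - 4)%N by lia.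
  rewrite -[_ *+ (p - 4)]mulr_natr natrB ?natr_p //; last by lia.
  move: (V.[x + 1]) (V.[x]) ((x + 1) ^+ (p - 5)) => a b y e.
  transitivity (- (- a - - b)); first by ring.
  by rewrite e; field.
have V' := deriv_of_diff hp szV (_ : (p - 5).+2 < p)%N Vdiff.
have hnn : n%:R * n.+1%:R = - 4%:R^-1 :> 'F_p.
  rewrite -natr1 (half_Fp hp hp2 hn) -/h.
  have -> : n%:R = h - 1 by rewrite /h -(half_Fp hp hp2 hn) addrK.
  by rewrite /h; field; apply/andP.
have tT : t = ('X + h%:P) ^+ 2 * - legTsum c ('X * ('X + 1)) n n.*2.
  rewrite /t /tailFp /legFp legF_legT; last by rewrite -addnn leq_addr.
  rewrite -/c -polyC_natr -[n.+1%:R]polyC_natr -polyCM hnn {1}half_sqr_poly // -/h.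
  by ring.
have ev : (legTsum c ('X * ('X + 1)) n n.*2).[- h] =
    legTsum (invFp p) (- 4%:R^-1) n n.*2.
  rewrite -[LHS]/(horner_eval (- h) _) (legTsum_rmorph (c' := invFp p)) => [|i].
    rewrite /= /horner_eval half_sqr_poly // hornerD hornerC horner_exp -/h.
    by rewrite hornerD hornerX hornerC addNr expr0n addr0.
  exact: hornerC.
have := t''E (- h); rewrite {1}tT deriv2_sqr hornerN ev V' ?hornerZ ?horner_comp; last by lia.
rewrite hornerD hornerX hornerC.
have -> : - h + 1 = h by rewrite /h; field.
rewrite bpoly_half5 //.
have -> : (p - 5).+1 = (p - 4)%N by lia.
rewrite -[_ *+ (p - 4)]mulr_natr natrB ?natr_p //; last by lia.
move: (legTsum _ _ _ _) (bernFp _ _) => a b e.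
apply: (mulfI h2); transitivity (- (- a *+ 2)); first by ring.
by rewrite e; field.
Qed.

(** * Congruences between rationals *)

Definition invQ (j : nat) : rat := j%:R^-1.

Lemma invQK (i : nat) : i.+1%:R * invQ i.+1 = 1.
Proof. by rewrite mulfV // pnatr_eq0. Qed.

Lemma Rd_invQ (p : nat) (hp : prime p) (i : nat) : (i.+1 < p)%N ->
  Rd (invQ i.+1) (invFp p i.+1).
Proof. by move=> hi; apply: Rd_natV; rewrite // gtnNdvd. Qed.

Lemma Rd_hsum (p : nat) (hp : prime p) (r k : nat) : (k < p)%N ->
  Rd (hsum invQ r k) (hsum (invFp p) r k).
Proof.
move=> hk; apply: Rd_sum_ord => i; apply/Rd_exp/Rd_invQ => //.
by apply: leq_ltn_trans hk.
Qed.

Lemma Rd_legP (p : nat) (hp : prime p) (v : rat) (w : 'F_p) (k : nat) : (k < p)%N ->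
  Rd v w -> Rd (legP invQ v k) (legP (invFp p) w k).
Proof.
move=> + hv; elim: k => [|k IH] hk.
  by rewrite /legP !big_ord0; apply: (Rd_nat p 1).
rewrite !legPS; apply: Rd_mul; first exact/IH/ltnW.
apply: Rd_mul; last exact/Rd_exp/Rd_invQ.
by apply: Rd_sub => //; apply: Rd_mul; apply: Rd_nat.
Qed.

Lemma Rd_legE (p : nat) (hp : prime p) (v : rat) (w : 'F_p) (k : nat) : (k < p)%N ->
  Rd v w -> Rd (legE invQ v k) (legE (invFp p) w k).
Proof.
move=> + hv; elim: k => [|k IH] hk; first exact: (Rd_nat p 0).
rewrite !legES; apply: Rd_mul; last exact/Rd_exp/Rd_invQ.
apply: Rd_add; last by apply: Rd_legP => //; apply: ltnW.
apply: Rd_mul; first exact/IH/ltnW.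
by apply: Rd_sub => //; apply: Rd_mul; apply: Rd_nat.
Qed.

Lemma Rd_legQ (p : nat) (hp : prime p) (v u : rat) (w y : 'F_p) (k : nat) :
  (k < p)%N -> Rd v w -> Rd u y -> Rd (legQ invQ v u k) (legQ (invFp p) w y k).
Proof.
move=> + hv hu; elim: k => [|k IH] hk; first exact: (Rd_nat p 0).
rewrite !legQS; apply: Rd_mul; last exact/Rd_exp/Rd_invQ.
apply: Rd_add; last by apply: Rd_legE => //; apply: ltnW.
apply: Rd_mul; first exact/IH/ltnW.
by apply: Rd_sub hu; apply: Rd_sub => //; apply: Rd_mul; apply: Rd_nat.
Qed.

Lemma Rd_legFE (p : nat) (hp : prime p) (v : rat) (w : 'F_p) (N : nat) : (N < p)%N ->
  Rd v w -> Rd (legFE invQ v N) (legFE (invFp p) w N).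
Proof.
move=> hN hv; apply: Rd_sum_ord => i; have hi := leq_ltn_trans (ltn_ord i) hN.
apply: Rd_mul; last exact: Rd_legE.
by apply: Rd_mul; [apply: Rd_hsum | apply: Rd_invQ].
Qed.

Lemma Rd_legFQ (p : nat) (hp : prime p) (v u : rat) (w y : 'F_p) (N : nat) :
  (N < p)%N -> Rd v w -> Rd u y -> Rd (legFQ invQ v u N) (legFQ (invFp p) w y N).
Proof.
move=> hN hv hu; apply: Rd_sum_ord => i; have hi := leq_ltn_trans (ltn_ord i) hN.
apply: Rd_mul; last exact: Rd_legQ.
by apply: Rd_mul; [apply: Rd_hsum | apply: Rd_invQ].
Qed.

Lemma Rd_prod (p : nat) (I : eqType) (s : seq I) (F : I -> rat) (G : I -> 'F_p) :
  (forall i, i \in s -> Rd (F i) (G i)) ->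
  Rd (\prod_(i <- s) F i) (\prod_(i <- s) G i).
Proof.
elim: s => [|i s IH] h; first by rewrite !big_nil; apply: (Rd_nat p 1).
rewrite !big_cons; apply: Rd_mul; first by apply: h; rewrite mem_head.
by apply: IH => j hj; apply: h; rewrite inE hj orbT.
Qed.

Lemma Rd_legTsum (p : nat) (hp : prime p) (v : rat) (w : 'F_p) (n N : nat) :
  (N < p)%N -> Rd v w -> Rd (legTsum invQ v n N) (legTsum (invFp p) w n N).
Proof.
move=> hN hv; rewrite /legTsum big_mkcond [X in Rd _ X]big_mkcond.
apply: Rd_sum_ord => i; have hi := leq_ltn_trans (ltn_ord i) hN.
case: ifP => _; last exact: (Rd_nat p 0).
apply: Rd_mul; first by apply: Rd_mul; [apply: Rd_hsum | apply: Rd_invQ].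
rewrite /legT big_mkcond [X in Rd _ (X * _)]big_mkcond.
apply: Rd_mul; apply: Rd_prod => j _.
  case: ifP => _; last exact: (Rd_nat p 1).
  by apply: Rd_sub => //; apply: Rd_mul; apply: Rd_nat.
by apply/Rd_exp/Rd_invQ => //; apply: leq_ltn_trans (ltn_ord j) hi.
Qed.

Lemma harmE (r k : nat) : harm r k = hsum invQ r k.
Proof.
rewrite /harm /hsum big_add1 big_mkord; apply: eq_bigr => i _.
by rewrite /invQ exprVn div1r.
Qed.

Lemma central_binS (k : nat) :
  (k.+1 * 'C(k.+1.*2, k.+1) = 2 * (k.*2.+1 * 'C(k.*2, k)))%N.
Proof.
have h1 := mul_bin_diag k.*2.+2 k; have h2 := mul_bin_down k.*2.+1 k.
by rewrite doubleS; move: h1 h2 => /=; lia.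
Qed.

(** At z = -1/2 the factor i(i+1) + 1/4 is (i + 1/2)^2, so the ratio of consecutive values is
    ((2k+1)/(2k+2))^2. *)
Lemma central_bin_legP (k : nat) :
  ('C(k.*2, k))%:R ^+ 2 / 16%:R ^+ k = legP invQ (- 4%:R^-1) k.
Proof.
elim: k => [|k IH]; first by rewrite /legP big_ord0.
have hk : k.+1%:R != 0 :> rat by rewrite pnatr_eq0.
have h : ('C(k.+1.*2, k.+1))%:R = 2%:R * (k.*2.+1%:R * ('C(k.*2, k))%:R) / k.+1%:R :> rat.
  by apply: (canRL (mulfK hk)); rewrite -!natrM mulnC central_binS.
have hq : 16%:R ^+ k != 0 :> rat by rewrite expf_neq0.
rewrite legPS -IH h (exprS 16%:R k) /invQ -[k.*2.+1%:R]natr1 -muln2 natrM.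
by field; apply/andP; split; rewrite // addrC natr1.
Qed.

Lemma sum_legF (N : nat) :
  \sum_(1 <= k < N.+1) harm 2 k / (k%:R * 16%:R ^+ k) * ('C(k.*2, k))%:R ^+ 2 =
  legF invQ (- 4%:R^-1) N.
Proof.
rewrite big_add1 big_mkord; apply: eq_bigr => k _.
by rewrite -central_bin_legP harmE invfM /invQ; ring.
Qed.

(** R_n vanishes at each 1 <= m <= n, so F_n(m) - F_n(m-1) = -2/m^3, while F_n(0) = 0. *)
Lemma legF_at_nat (n m : nat) : (m <= n)%N ->
  legF invQ (m%:R * (m%:R + 1)) n = - (hsum invQ 3 m *+ 2).
Proof.
elim: m => [|m IH] hm.
  rewrite mul0r /hsum big_ord0 mul0rn oppr0 /legF big1 // => k _.
  by rewrite -(mul0r (0 + 1)) legP_legR ?oppr0 ?(mul0r, mulr0) // => i _; apply: invQK.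
have hm0 : m.+1%:R != 0 :> rat by rewrite pnatr_eq0.
have := @legF_diff _ invQ m.+1%:R n (fun i _ => invQK i).
have -> : legR invQ m.+1%:R n = 0.
  rewrite /legR (bigD1 (Ordinal hm)) //= -exprMn invQK expr1n subrr.
  by rewrite mul0r.
have -> : (m.+1%:R - 1) * m.+1%:R = m%:R * (m%:R + 1) :> rat by rewrite -natr1 addrK.
rewrite IH ?(ltnW hm) // mul0r sub0r => e.
apply: (mulfI (expf_neq0 3 hm0)).
rewrite [hsum invQ 3 m.+1]big_ord_recr /= -/(hsum invQ 3 m).
suff gen (F H z c : rat) : z ^+ 3 * (F - - (H *+ 2)) = - 1 *+ 2 -> z * c = 1 ->
    z ^+ 3 * F = z ^+ 3 * - ((H + c ^+ 3) *+ 2) by exact: gen e (invQK m).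
move=> {}e hz.
transitivity (z ^+ 3 * (F - - (H *+ 2)) - z ^+ 3 * H *+ 2); first by ring.
rewrite e; transitivity (- (z * c) ^+ 3 *+ 2 - z ^+ 3 * H *+ 2); last by ring.
by rewrite hz expr1n.
Qed.

(** * Expansions of harmonic sums under d -> p - d *)

Lemma pint_invQ (p : nat) (hp : prime p) (d : nat) : (0 < d < p)%N ->
  p_integral p (invQ d).
Proof. by move=> /andP[d0 dp]; apply: pint_natV; rewrite // gtnNdvd. Qed.

Lemma pint_sum (p : nat) (hp : prime p) (n : nat) (F : 'I_n -> rat) :
  (forall i, p_integral p (F i)) -> p_integral p (\sum_i F i).
Proof.
move=> h; elim/big_ind: _ => //; first exact: (pint_nat hp 0).
exact: pint_add.
Qed.

Lemma pint_exp (p : nat) (hp : prime p) (x : rat) (r : nat) :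
  p_integral p x -> p_integral p (x ^+ r).
Proof.
move=> h; elim: r => [|r IH]; first exact: (pint_nat hp 1).
by rewrite exprS; apply: pint_mul.
Qed.

(** The geometric expansion of 1/(p-d) in powers of p/d, with its exact remainder. *)
Lemma invQ_compl1 (p d : nat) : (0 < d < p)%N ->
  invQ d + invQ (p - d) =
  - (p%:R * invQ d ^+ 2 + p%:R ^+ 2 * invQ d ^+ 3 + p%:R ^+ 3 * invQ d ^+ 4
     + p%:R ^+ 4 * invQ d ^+ 5) + p%:R ^+ 5 * (invQ d ^+ 5 * invQ (p - d)).
Proof.
move=> /andP[d0 dp]; rewrite /invQ natrB; last exact: ltnW.
have hd : d%:R != 0 :> rat by rewrite pnatr_eq0 -lt0n.
have hpd : p%:R - d%:R != 0 :> rat by rewrite subr_eq0 eqr_nat gtn_eqF.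
by field; apply/andP.
Qed.

(** The binomial expansion of (p-d)^(-3), with its exact remainder. *)
Lemma invQ_compl3 (p d : nat) : (0 < d < p)%N ->
  invQ d ^+ 3 + invQ (p - d) ^+ 3 =
  - (3%:R * p%:R * invQ d ^+ 4 + 6%:R * p%:R ^+ 2 * invQ d ^+ 5)
  + p%:R ^+ 3 * ((10%:R * d%:R ^+ 2 - 15%:R * p%:R * d%:R + 6%:R * p%:R ^+ 2)
     * invQ d ^+ 5 * invQ (p - d) ^+ 3).
Proof.
move=> /andP[d0 dp]; rewrite /invQ natrB; last exact: ltnW.
have hd : d%:R != 0 :> rat by rewrite pnatr_eq0 -lt0n.
have hpd : p%:R - d%:R != 0 :> rat by rewrite subr_eq0 eqr_nat gtn_eqF.
by field; apply/andP.
Qed.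

Lemma invQM (a b : nat) : invQ (a * b) = invQ a * invQ b.
Proof. by rewrite /invQ natrM invfM. Qed.

(** Taken at q = 1 it covers all d <= n, and at q = 2 all even d < p; in both cases the left side
    becomes H_(p-1). *)
Lemma sum_compl1 (p n q : nat) (hp : prime p) (hq : (0 < q)%N)
    (hn : (q * n < p)%N) : exists2 e, p_integral p e &
  \sum_(i < n) (invQ (q * i.+1) + invQ (p - q * i.+1)) =
  - (p%:R * invQ q ^+ 2 * hsum invQ 2 n + p%:R ^+ 2 * invQ q ^+ 3 * hsum invQ 3 n
     + p%:R ^+ 3 * invQ q ^+ 4 * hsum invQ 4 n
     + p%:R ^+ 4 * invQ q ^+ 5 * hsum invQ 5 n) + p%:R ^+ 5 * e.
Proof.
have hd (i : 'I_n) : (0 < q * i.+1 < p)%N.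
  rewrite muln_gt0 hq /=; apply: leq_ltn_trans hn.
  by rewrite leq_pmul2l.
exists (\sum_(i < n) (invQ (q * i.+1) ^+ 5 * invQ (p - q * i.+1))).
  apply: pint_sum => // i; have hi := hd i.
  apply: pint_mul => //; first by apply: pint_exp => //; apply: pint_invQ.
  by apply: pint_invQ => //; move: hi; lia.
rewrite /hsum !mulr_sumr -!big_split /= -sumrN -big_split /=; apply: eq_bigr => i _.
by rewrite invQ_compl1 // !invQM; ring.
Qed.

Lemma sum_compl3 (p n q : nat) (hp : prime p) (hq : (0 < q)%N)
    (hn : (q * n < p)%N) : exists2 e, p_integral p e &
  \sum_(i < n) (invQ (q * i.+1) ^+ 3 + invQ (p - q * i.+1) ^+ 3) =
  - (3%:R * p%:R * invQ q ^+ 4 * hsum invQ 4 n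
     + 6%:R * p%:R ^+ 2 * invQ q ^+ 5 * hsum invQ 5 n) + p%:R ^+ 3 * e.
Proof.
have hd (i : 'I_n) : (0 < q * i.+1 < p)%N.
  rewrite muln_gt0 hq /=; apply: leq_ltn_trans hn.
  by rewrite leq_pmul2l.
pose g d : rat := (10%:R * d%:R ^+ 2 - 15%:R * p%:R * d%:R + 6%:R * p%:R ^+ 2).
exists (\sum_(i < n) (g (q * i.+1)%N * invQ (q * i.+1) ^+ 5
                      * invQ (p - q * i.+1) ^+ 3)).
  apply: pint_sum => // i; have hi := hd i.
  apply: pint_mul => //; last by apply/pint_exp/pint_invQ => //; move: hi; lia.
  apply: pint_mul => //; last by apply/pint_exp/pint_invQ.
  have pn := pint_nat hp; rewrite /g.
  have h2 := pint_mul hp (pn 15%N) (pn p).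
  have h3 := pint_opp hp (pint_mul hp h2 (pn (q * i.+1)%N)).
  have h1 := pint_mul hp (pn 10%N) (pint_exp hp 2 (pn (q * i.+1)%N)).
  have h4 := pint_add hp (pint_add hp h1 h3) (pint_mul hp (pn 6%N) (pint_exp hp 2 (pn p))).
  exact: h4.
rewrite /hsum !mulr_sumr -!big_split /= -sumrN -big_split /=; apply: eq_bigr => i _.
by rewrite invQ_compl3 // -/(g _); move: (g _) => y; rewrite !invQM; ring.
Qed.

Lemma hsum3_congr (p n : nat) (hp : prime p) (hp5 : (5 < p)%N) (hn : p = n.*2.+1) :
  exists2 e, p_integral p e &
  - (hsum invQ 3 n *+ 2) =
  - 12%:R * (hsum invQ 1 n.*2 / p%:R ^+ 2)
  - 27%:R / 10%:R * p%:R ^+ 2 * hsum invQ 5 n + p%:R ^+ 3 * e.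
Proof.
have hP : p%:R != 0 :> rat by rewrite pnatr_eq0; lia.
have hn1 : (1 * n < p)%N by lia.
have hn2 : (2 * n < p)%N by lia.
have [e1 he1 E1] := sum_compl1 hp (ltn0Sn 0) hn1.
have [e2 he2 E2] := sum_compl1 hp (ltn0Sn 1) hn2.
have [e3 he3 E3] := sum_compl3 hp (ltn0Sn 0) hn1.
have [e4 he4 E4] := sum_compl3 hp (ltn0Sn 1) hn2.
have f1 (f : nat -> rat) :
    \sum_(i < n.*2) f i.+1 = \sum_(i < n) (f (1 * i.+1)%N + f (p - 1 * i.+1)%N).
  by rewrite big_fold; apply: eq_bigr => i _; rewrite !mul1n hn.
have f2 (f : nat -> rat) :
    \sum_(i < n.*2) f i.+1 = \sum_(i < n) (f (2 * i.+1)%N + f (p - 2 * i.+1)%N).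
  by rewrite big_even_odd; apply: eq_bigr => i _; rewrite !mul2n hn.
have S1 : hsum invQ 1 n.*2 = \sum_(i < n.*2) invQ i.+1.
  by apply: eq_bigr => i _; rewrite expr1.
move: E1 E2; rewrite -(f1 invQ) -(f2 invQ) -S1 => E1 E2.
move: E3 E4; rewrite -(f1 (fun d => invQ d ^+ 3)) -(f2 (fun d => invQ d ^+ 3)) => E3 E4.
(* The coefficients are those left by the elimination below; 15 is a p-adic unit because p > 5. *)
exists (4%:R * (4%:R * e2 - e1) + 16%:R / 15%:R * (e3 - e4)).
  have h15 : p_integral p 15%:R^-1.
    apply: pint_natV => //; rewrite (Euclid_dvdM 3 5 hp) !dvdn_prime2 //.
    by apply/norP; split; lia.
  have pn := pint_nat hp.
  have h1 := pint_mul hp (pn 4%N) (pint_add hp (pint_mul hp (pn 4%N) he2) (pint_opp hp he1)).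
  have h2 := pint_mul hp (pint_mul hp (pn 16%N) h15) (pint_add hp he3 (pint_opp hp he4)).
  by have h3 := pint_add hp h1 h2.
have i1 : invQ 1 = 1 by rewrite /invQ invr1.
have i2 : invQ 2 = 2%:R^-1 by [].
rewrite i1 !expr1n !mulr1 in E1 E3; rewrite i2 in E2 E4.
suff gen (P A H2 H3 H4 H5 S : rat) : P != 0 ->
    A = - (P * H2 + P ^+ 2 * H3 + P ^+ 3 * H4 + P ^+ 4 * H5) + P ^+ 5 * e1 ->
    A = - (P * 2%:R^-1 ^+ 2 * H2 + P ^+ 2 * 2%:R^-1 ^+ 3 * H3
      + P ^+ 3 * 2%:R^-1 ^+ 4 * H4 + P ^+ 4 * 2%:R^-1 ^+ 5 * H5) + P ^+ 5 * e2 ->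
    S = - (3%:R * P * H4 + 6%:R * P ^+ 2 * H5) + P ^+ 3 * e3 ->
    S = - (3%:R * P * 2%:R^-1 ^+ 4 * H4 + 6%:R * P ^+ 2 * 2%:R^-1 ^+ 5 * H5)
      + P ^+ 3 * e4 ->
    - (H3 *+ 2) = - 12%:R * (A / P ^+ 2) - 27%:R / 10%:R * P ^+ 2 * H5
      + P ^+ 3 * (4%:R * (4%:R * e2 - e1) + 16%:R / 15%:R * (e3 - e4)).
  exact: gen hP E1 E2 E3 E4.
move=> P0 F1 F2 F3 F4.
(* Eliminating [H2] from the first pair and [H4] between the two pairs. *)
have G1 : A *+ 3 = (A *+ 4) - A by ring.
have G2 : P * H4 = 16%:R / 45%:R * (P ^+ 3 * (e3 - e4)) - 31%:R / 15%:R * P ^+ 2 * H5.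
  apply/eqP; rewrite -subr_eq0; apply/eqP.
  transitivity ((S - S) * (16%:R / 45%:R)); last by rewrite subrr mul0r.
  by rewrite {1}F4 F3; field.
have G3 : A *+ 3 = 2%:R^-1 * P ^+ 2 * H3 + 3%:R / 4%:R * P ^+ 2 * (P * H4)
    + 7%:R / 8%:R * P ^+ 4 * H5 + P ^+ 5 * (4%:R * e2 - e1).
  by rewrite G1 {1}F2 {1}F1; field.
have G4 : A = (A *+ 3) / 3%:R by field.
by rewrite G4 G3 G2; field.
Qed.

(** The tail is exactly p^2/4 times [legTsum], which is 62b modulo p. *)
Lemma tail_congr (p n : nat) (hp : prime p) (hp5 : (5 < p)%N) (hn : p = n.*2.+1) :
  congr_pm p 3 (legF invQ (- 4%:R^-1) n.*2 - legF invQ (- 4%:R^-1) n)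
    (31%:R / 2%:R * p%:R ^+ 2 * bernoulli (p - 5)).
Proof.
have hP : p%:R != 0 :> rat by rewrite pnatr_eq0; lia.
have h4 : ~~ (p %| 4)%N by rewrite gtnNdvd //; lia.
have h2n : (n.*2 < p)%N by rewrite hn.
have hT := Rd_legTsum hp n h2n (Rd_opp (Rd_natV hp h4)).
rewrite (legTsum_Fp hp hp5 hn) in hT.
have hb : Rd (bernoulli (p - 5)) (bernFp p (p - 5)) by apply: Rd_bernoulli => //; lia.
have := Rd_sub hT (Rd_mul hb (Rd_nat p 62)).
rewrite subrr => /(Rd0_divp hp)[y hy ey].
have pE : p%:R = n%:R *+ 2 + 1 :> rat by rewrite {1}hn -natr1 -muln2 natrM mulr_natr.
rewrite /congr_pm legF_legT; last by rewrite -addnn leq_addr.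
suff -> : (n%:R * n.+1%:R - - 4%:R^-1) * legTsum invQ (- 4%:R^-1) n n.*2
    - 31%:R / 2%:R * p%:R ^+ 2 * bernoulli (p - 5) = (p ^ 3)%:R * (4%:R^-1 * y).
  rewrite mulrAC divff ?mul1r; last by rewrite natrX expf_neq0.
  by apply: pint_mul => //; apply: pint_natV.
move: ey; move: (legTsum _ _ _ _) (bernoulli _) => T b ey.
have -> : T = (T - b * 62%:R) + b * 62%:R by ring.
by rewrite ey natrX -natr1 pE; field.
Qed.

(** As -1/4 + p^2/4 = n(n+1), the Taylor expansion links the head to F_n(n) = -2 H_n^(3). *)
Lemma head_congr (p n : nat) (hp : prime p) (hp5 : (5 < p)%N) (hn : p = n.*2.+1) :
  congr_pm p 3 (legF invQ (- 4%:R^-1) n)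
    (- 12%:R * (hsum invQ 1 n.*2 / p%:R ^+ 2)
     - 148%:R / 10%:R * p%:R ^+ 2 * bernoulli (p - 5)).
Proof.
have hP : p%:R != 0 :> rat by rewrite pnatr_eq0; lia.
have h4 : ~~ (p %| 4)%N by rewrite gtnNdvd //; lia.
have h10 : ~~ (p %| 10)%N.
  by rewrite (Euclid_dvdM 2 5 hp) !dvdn_prime2 //; apply/norP; split; lia.
have h16 : ~~ (p %| 16)%N by rewrite (Euclid_dvdX 2 4 hp) dvdn_prime2 // ; lia.
have hnp : (n < p)%N by rewrite hn; lia.
have h10F : 10%:R != 0 :> 'F_p by rewrite natr_Fp_eq0.
have h4F : 4%:R != 0 :> 'F_p by rewrite natr_Fp_eq0.
have hv := Rd_opp (Rd_natV hp h4).
have hE := Rd_legFE hp hnp hv.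
rewrite (legFE_Fp hp hp5 hn) in hE.
have h5 := Rd_hsum hp 5 hnp; rewrite (hsum5_Fp hp hp5 hn) in h5.
have hb : Rd (bernoulli (p - 5)) (bernFp p (p - 5)) by apply: Rd_bernoulli => //; lia.
have hu := Rd_mul (Rd_exp 2 (Rd_nat p p)) (Rd_natV hp h4).
have hQ := Rd_pint hp (Rd_legFQ hp hnp hv hu).
have [e he E3] := hsum3_congr hp hp5 hn.
(* Here 148/10 arises: -124/4 + 27 * 6/10 + 148/10 = 0. *)
have := Rd_add (Rd_sub (Rd_mul hE (Rd_natV hp h4))
    (Rd_mul (Rd_mul (Rd_nat p 27) (Rd_natV hp h10)) h5))
  (Rd_mul (Rd_mul (Rd_nat p 148) (Rd_natV hp h10)) hb).
set z := (X in Rd _ X).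
have -> : z = 0 by rewrite /z; field; apply/andP.
move=> /(Rd0_divp hp)[y hy ey].
have pE : p%:R = n%:R *+ 2 + 1 :> rat by rewrite {1}hn -natr1 -muln2 natrM mulr_natr.
have := legF_taylor invQ (- 4%:R^-1) (p%:R ^+ 2 / 4%:R) n.
have -> : - 4%:R^-1 + p%:R ^+ 2 / 4%:R = n%:R * (n%:R + 1) :> rat by rewrite pE; field.
rewrite legF_at_nat // E3 => eF.
suff hF : legF invQ (- 4%:R^-1) n - (- 12%:R * (hsum invQ 1 n.*2 / p%:R ^+ 2)
     - 148%:R / 10%:R * p%:R ^+ 2 * bernoulli (p - 5)) =
    (p ^ 3)%:R * (e + y - p%:R * 16%:R^-1 * legFQ invQ (- 4%:R^-1) (p%:R ^+ 2 / 4%:R) n).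
  rewrite /congr_pm hF mulrAC divff ?mul1r; last by rewrite natrX expf_neq0.
  have hR := pint_mul hp (pint_mul hp (pint_nat hp p) (pint_natV hp h16)) hQ.
  exact: (pint_add hp (pint_add hp he hy) (pint_opp hp hR)).
rewrite natrX.
suff gen (P F X Q H A b : rat) : P != 0 ->
    - 12%:R * (A / P ^+ 2) - 27%:R / 10%:R * P ^+ 2 * H + P ^+ 3 * e
      = F - P ^+ 2 / 4%:R * X + (P ^+ 2 / 4%:R) ^+ 2 * Q ->
    X * 4%:R^-1 - 27%:R * 10%:R^-1 * H + 148%:R * 10%:R^-1 * b = P * y ->
    F - (- 12%:R * (A / P ^+ 2) - 148%:R / 10%:R * P ^+ 2 * b) =
    P ^+ 3 * (e + y - P * 16%:R^-1 * Q) by exact: gen hP eF ey.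
move=> P0 {}eF {}ey.
transitivity (F - P ^+ 2 / 4%:R * X + (P ^+ 2 / 4%:R) ^+ 2 * Q
  + P ^+ 2 * (X * 4%:R^-1 - 27%:R * 10%:R^-1 * H + 148%:R * 10%:R^-1 * b)
  + 27%:R / 10%:R * P ^+ 2 * H + 12%:R * (A / P ^+ 2)
  - P ^+ 3 * (P * 16%:R^-1 * Q)); first by field.
by rewrite -eF ey; ring.
Qed.

Lemma congruences_at_5 :
  congr_pm 5 3
    (\sum_(1 <= k < 5)
       harm 2 k / (k%:R * 16%:R ^+ k) * ('C(k.*2, k))%:R ^+ 2)
    (- 12%:R * (harm 1 4 / (5%:R ^+ 2))
       + 7%:R / 10%:R * 5%:R ^+ 2 * bernoulli 0)
  /\
  congr_pm 5 3
    (\sum_(3 <= k < 5)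
       harm 2 k / (k%:R * 16%:R ^+ k) * ('C(k.*2, k))%:R ^+ 2)
    (31%:R / 2%:R * 5%:R ^+ 2 * bernoulli 0).
Proof.
have hE r k : harm r k.+1 = harm r k + 1 / k.+1%:R ^+ r.
  by rewrite !harmE /hsum big_ord_recr /= /invQ exprVn div1r.
have h0 r : harm r 0 = 0 by rewrite harmE /hsum big_ord0.
have b1 : 'C(1.*2, 1) = 2%N by [].
have b2 : 'C(2.*2, 2) = 6%N by [].
have b3 : 'C(3.*2, 3) = 20%N by [].
have b4 : 'C(4.*2, 4) = 70%N by [].
have b0 : bernoulli 0 = 1 by [].
have i1 (f : nat -> rat) : \sum_(1 <= k < 5) f k = f 1%N + (f 2%N + (f 3%N + f 4%N)).
  by do 4!rewrite big_ltn //; rewrite big_geq // addr0.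
have i3 (f : nat -> rat) : \sum_(3 <= k < 5) f k = f 3%N + f 4%N.
  by do 2!rewrite big_ltn //; rewrite big_geq // addr0.
have H1 : harm 2 1 = 1 by rewrite hE h0; field.
have H2 : harm 2 2 = 5%:R / 4%:R by rewrite hE H1; field.
have H3 : harm 2 3 = 49%:R / 36%:R by rewrite hE H2; field.
have H4 : harm 2 4 = 205%:R / 144%:R by rewrite hE H3; field.
have A4 : harm 1 4 = 25%:R / 12%:R by rewrite !hE h0; field.
rewrite /congr_pm i1 i3 b0 b1 b2 b3 b4 H1 H2 H3 H4 A4 natrX.
have h5 : prime 5 by [].
have n16 : ~~ (5 %| 16)%N by [].
have n27 : ~~ (5 %| 27)%N by [].
(* Both quotients are minus an integer over 16^5 * 27, which is prime to 5. The numerators 3644533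
   and 87749749 are written in base 1000. *)
have pD := pint_mul h5 (pint_exp h5 5 (pint_natV h5 n16)) (pint_natV h5 n27).
have pN a b c d :=
  pint_opp h5 (pint_mul h5 (pint_add h5 (pint_mul h5 (pint_add h5
    (pint_mul h5 (pint_nat h5 a) (pint_nat h5 d)) (pint_nat h5 b)) (pint_nat h5 d))
    (pint_nat h5 c)) pD).
split.
  rewrite [X in p_integral 5 X](_ : _ = - (((3%:R * 1000%:R + 644%:R) * 1000%:R + 533%:R)
    * (16%:R^-1 ^+ 5 * 27%:R^-1))); first exact: (pN 3 644 533 1000)%N.
  lra.
rewrite [X in p_integral 5 X](_ : _ = - (((87%:R * 1000%:R + 749%:R) * 1000%:R + 749%:R)
  * (16%:R^-1 ^+ 5 * 27%:R^-1))); first exact: (pN 87 749 749 1000)%N.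
lra.
Qed.

Unset Implicit Arguments.

Theorem theorem1p1 (p : nat) (hp : prime p) (hp3 : (3 < p)%N) :
  congr_pm p 3
    (\sum_(1 <= k < p)
       harm 2 k / (k%:R * 16%:R ^+ k) * ('C(k.*2, k))%:R ^+ 2)
    (- 12%:R * (harm 1 p.-1 / (p%:R ^+ 2))
       + 7%:R / 10%:R * p%:R ^+ 2 * bernoulli (p - 5))
  /\
  congr_pm p 3
    (\sum_(p.+1./2 <= k < p)
       harm 2 k / (k%:R * 16%:R ^+ k) * ('C(k.*2, k))%:R ^+ 2)
    (31%:R / 2%:R * p%:R ^+ 2 * bernoulli (p - 5)).
Proof.
have [->|p5] := eqVneq p 5%N; first exact: congruences_at_5.
have hp5 : (5 < p)%N.
  rewrite ltn_neqAle eq_sym p5 /= ltn_neqAle hp3 andbT.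
  by apply/eqP => p4; move: hp; rewrite -p4.
have [n hn] : exists n, p = n.*2.+1.
  by exists p./2; rewrite -[LHS]odd_double_half; case/even_prime: hp => [p2|->] //; lia.
have tailE : \sum_(p.+1./2 <= k < p) harm 2 k / (k%:R * 16%:R ^+ k) * ('C(k.*2, k))%:R ^+ 2
    = legF invQ (- 4%:R^-1) n.*2 - legF invQ (- 4%:R^-1) n.
  rewrite -!sum_legF -hn; have -> : p.+1./2 = n.+1 by rewrite hn -doubleS doubleK.
  have h : (n.+1 <= p)%N by rewrite hn ltnS -addnn leq_addr.
  by rewrite (big_cat_nat (ltn0Sn n : (1 <= n.+1)%N) h) //= [RHS]addrC addKr.
have tail := tail_congr hp hp5 hn.
split; last by rewrite tailE.
have := pint_add hp (head_congr hp hp5 hn) tail; rewrite -mulrDl /congr_pm.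
have -> : harm 1 p.-1 = hsum invQ 1 n.*2 by rewrite harmE {1}hn.
have -> : \sum_(1 <= k < p) harm 2 k / (k%:R * 16%:R ^+ k) * ('C(k.*2, k))%:R ^+ 2
    = legF invQ (- 4%:R^-1) n.*2 by rewrite -sum_legF -hn.
congr (is_true (p_integral p (_ / _))).
(* Adding head and tail, 7/10 = 31/2 - 148/10. *)
suff gen (F G A P b : rat) : F - (A - 148%:R / 10%:R * P * b) + (G - F - 31%:R / 2%:R * P * b)
    = G - (A + 7%:R / 10%:R * P * b) by exact: gen.
by field.
Qed.
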